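(* Let $S = R\cup B$ be a finite set of points in the plane in general position (no three collinear), colored red ($R$) and blue ($B$), such that $R$ and $B$ are not linearly separable. Then $S$ has a balanced convex $4$-hole if and only if one of the following holds: (1) $CH(B)\subset CH(R)$, $|R|=3$, $|B|\ge 2$, and there is an edge $\overline{uv}$ of $CH(B)$ ($u,v\in B$) such that one of the open half-planes bounded by the line through $u,v$ contains exactly two red points and no blue point; (2) $CH(R)\subset CH(B)$, $|B|=3$, $|R|\ge 2$, and there is an edge $\overline{uv}$ of $CH(R)$ ($u,v\in R$) such that one of the open half-planes bounded by the line through $u,v$ contains exactly two blue points and no red point; (3) $CH(B)\subset CH(R)$, $|R|\ge 4$, $|B|\ge 2$; (4) $CH(R)\subset CH(B)$, $|B|\ge 4$, $|R|\ge 2$; (5) the boundaries of $CH(B)$ and $CH(R)$ intersect each other.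
   Context: A $4$-hole of $S$ is a simple quadrilateral with vertices in $S$ and no point of $S$ in its interior; it is convex if the quadrilateral is convex, and balanced if it has exactly two red and two blue vertices. $CH(X)$ denotes the convex hull of $X$. $R$ and $B$ are linearly separable if some line has all of $R$ strictly on one side and all of $B$ strictly on the other. *)

(* Defs.v *)
From HB Require Import structures.
From mathcomp Require Import all_boot all_order all_algebra.
Set Implicit Arguments. Unset Strict Implicit. Unset Printing Implicit Defensive.
Import Order.TTheory GRing.Theory Num.Theory.
Local Open Scope ring_scope.

Section Geometry.
Variable R : realFieldType.
Definition point := (R * R)%type.

(* twice the signed area of triangle pqr: > 0 iff r is strictly left of line pq *)
Definition orient (p q r : point) : R :=
  (q.1 - p.1) * (r.2 - p.2) - (q.2 - p.2) * (r.1 - p.1).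

Definition general_position (S : seq point) : Prop :=
  forall p q r, p \in S -> q \in S -> r \in S ->
    p != q -> q != r -> p != r -> orient p q r != 0.

Definition lin_separable (X Y : seq point) : Prop :=
  exists a b c : R, (a != 0 \/ b != 0) /\
    (forall p, p \in X -> 0 < a * p.1 + b * p.2 + c) /\
    (forall p, p \in Y -> a * p.1 + b * p.2 + c < 0).

Definition in_hull (X : seq point) (p : point) : Prop :=
  exists w : point -> R, (forall x, x \in X -> 0 <= w x) /\
    \sum_(x <- X) w x = 1 /\
    \sum_(x <- X) w x * x.1 = p.1 /\
    \sum_(x <- X) w x * x.2 = p.2.

Definition hull_subset (X Y : seq point) : Prop :=
  forall p, in_hull X p -> in_hull Y p.

Definition in_hull_interior (X : seq point) (p : point) : Prop :=
  exists e : R, 0 < e /\ forall q : point,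
    (q.1 - p.1) ^+ 2 + (q.2 - p.2) ^+ 2 < e -> in_hull X q.

Definition on_hull_boundary (X : seq point) (p : point) : Prop :=
  in_hull X p /\ ~ in_hull_interior X p.

Definition hull_edge (X : seq point) (u v : point) : Prop :=
  [/\ u \in X, v \in X, u != v &
      (forall w, w \in X -> 0 <= orient u v w) \/
      (forall w, w \in X -> orient u v w <= 0)].

Definition halfplane_two_none (u v : point) (Y X : seq point) : Prop :=
  ((count (fun p => 0 < orient u v p) Y = 2%N) /\ (forall p, p \in X -> ~ (0 < orient u v p)))
  \/
  ((count (fun p => orient u v p < 0) Y = 2%N) /\ (forall p, p \in X -> ~ (orient u v p < 0))).

(* p is strictly inside the convex quadrilateral abcd (counterclockwise) *)
Definition in_quad_interior (a b c d p : point) : Prop :=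
  [/\ 0 < orient a b p, 0 < orient b c p, 0 < orient c d p & 0 < orient d a p].

Definition balanced_convex_4hole (Rd Bl : seq point) : Prop :=
  exists a b c d : point,
    [/\ all (fun x => x \in Rd ++ Bl) [:: a; b; c; d],
        uniq [:: a; b; c; d],
        [/\ 0 < orient a b c, 0 < orient b c d, 0 < orient c d a & 0 < orient d a b],
        (forall p, p \in Rd ++ Bl -> ~ in_quad_interior a b c d p) &
        count (fun x => x \in Rd) [:: a; b; c; d] = 2%N /\
        count (fun x => x \in Bl) [:: a; b; c; d] = 2%N].
End Geometry.

(* Main.v *)
(** A red and a blue segment that cross span an alternating convex quadrilateral; replacing a vertex
    by an interior point of its colour on the same side keeps the crossing, so a crossing with fewest
    interior points is a hole. A common boundary point of the hulls lies on such a crossing.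

    If the blue hull is inside the red one and nothing crosses, all blue points lie in one red triangle
    [T] without red points inside. A blue hull edge having two vertices of [T] on its outer side spans a
    hole with them. Otherwise every blue hull edge cuts off exactly one vertex of [T]; a fourth red point
    [q], chosen so that no other red point is in the hull of [T] and [q], then yields a hole, either with
    a blue hull edge or, when [q] is behind a vertex [b] of [T], with two blue points on one side of the
    line [b q]. When [T] is all of the red set, a hole produces such an edge: take the tangent from [b] to
    the blue hull, and otherwise its contact point would be inside the hole.

    If neither hull contains the other but they meet, walking along one boundary leads to a point of
    the other. All existence arguments are finite, so no completeness of the field is needed. *)

Require Import Defs.
From HB Require Import structures.
From mathcomp Require Import all_boot all_order all_algebra.
From mathcomp Require Import ring lra.
From Stdlib Require Import Classical.
Import Order.TTheory GRing.Theory Num.Theory.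
Local Open Scope ring_scope.
Set Implicit Arguments.
Unset Strict Implicit.
Unset Printing Implicit Defensive.

Section BalancedHoles.
Variable F : realFieldType.
Implicit Types (a b c d p q u v w x y : point F) (X Y : seq (point F)).

(** * Orientations and tangents *)

(** Inner product of the vectors from [p]. For [a], [b] collinear with [p] its sign tells whether
    [p] separates them. *)
Definition dot p a b : F := (a.1 - p.1) * (b.1 - p.1) + (a.2 - p.2) * (b.2 - p.2).

Lemma orientC a b c : orient a b c = orient b c a.
Proof. rewrite /orient; ring. Qed.

Lemma orientN a b c : orient b a c = - orient a b c.
Proof. rewrite /orient; ring. Qed.

Lemma orient_l a b : orient a b a = 0.
Proof. rewrite /orient; ring. Qed.

Lemma orient_r a b : orient a b b = 0.
Proof. rewrite /orient; ring. Qed.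

Lemma orient_sum a b c p :
  orient a b p + orient b c p + orient c a p = orient a b c.
Proof. rewrite /orient; ring. Qed.

Lemma orient_neq a b c : orient a b c != 0 -> [/\ a != b, b != c & a != c].
Proof.
move=> h; split; apply: contra h => /eqP ->; apply/eqP; rewrite /orient; ring.
Qed.

(* Cramer's rule: the barycentric coordinates of p in the triangle abc are ratios of orientations. *)
Lemma bary a b c x y p :
  orient a b c * orient x y p =
  orient b c p * orient x y a + orient c a p * orient x y b + orient a b p * orient x y c.
Proof. rewrite /orient; ring. Qed.

(** For [a != p], the vector from [p] to [b] is the multiple [dot p a b / dot p a a] of the one to
    [a]; the denominator is cleared. *)
Lemma orient_parallel p a b x :
  orient p a b = 0 -> dot p a a * orient p b x = dot p a b * orient p a x.
Proof.
move=> h; have : dot p a a * orient p b x - dot p a b * orient p a x =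
   - orient p a b * dot p a x by rewrite /orient /dot; ring.
by rewrite h oppr0 mul0r => /eqP; rewrite subr_eq0 => /eqP.
Qed.

Lemma dot_gt0 p a : a != p -> 0 < dot p a a.
Proof.
case: a p => a1 a2 [p1 p2]; rewrite /dot /= => h.
have h1 : 0 <= (a1 - p1) * (a1 - p1) by rewrite -expr2 sqr_ge0.
have h2 : 0 <= (a2 - p2) * (a2 - p2) by rewrite -expr2 sqr_ge0.
rewrite lt0r addr_ge0 // andbT paddr_eq0 // !mulf_eq0 !orbb !subr_eq0.
by apply: contra h => /andP [/eqP -> /eqP ->].
Qed.

(** The sign [s] selects one of the two tangents from [p]. By induction, the tangent point [t] of
    the tail gives way to a new [y] on its wrong side. A [z] on the wrong side of [y] would then
    surround [p] together with [t] and [y], or lie on the ray from [p] through [t], hence on the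
    same side of [y] as [t]. *)
Lemma tangent_point (s : F) p Y : s = 1 \/ s = -1 ->
  Y != [::] -> p \notin Y ->
  (forall a b, a \in Y -> b \in Y -> orient p a b = 0 -> 0 <= dot p a b) ->
  (forall a b c, a \in Y -> b \in Y -> c \in Y ->
     0 < orient p a b -> 0 < orient p b c -> 0 < orient p c a -> False) ->
  exists2 t, t \in Y & forall x, x \in Y -> 0 <= s * orient p t x.
Proof.
move=> hs; elim: Y => // y Y IH _; rewrite inE negb_or => /andP [py pY] hd ht.
have [Y0|Yn] := eqVneq Y [::].
  exists y; first by rewrite mem_head.
  by move=> x; rewrite Y0 inE => /eqP ->; rewrite orient_r mulr0.
have [| |t tY htY] := IH Yn pY.
- by move=> a b aY bY; apply: hd; rewrite inE ?aY ?bY orbT.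
- by move=> a b c aY bY cY; apply: ht; rewrite inE ?aY ?bY ?cY orbT.
have [hy|hy] := leP 0 (s * orient p t y).
  exists t; first by rewrite inE tY orbT.
  by move=> x; rewrite inE => /orP [/eqP -> //|]; exact: htY.
exists y; first by rewrite mem_head.
move=> z; rewrite inE => /orP [/eqP ->|zY]; first by rewrite orient_r mulr0.
rewrite leNgt; apply/negP => hz.
have my : y \in y :: Y by rewrite mem_head.
have mt : t \in y :: Y by rewrite inE tY orbT.
have mz : z \in y :: Y by rewrite inE zY orbT.
have h1 := htY _ zY.
have [e|n] := eqVneq (orient p t z) 0; last first.
  have e1 a b : orient p a b = - orient p b a by rewrite /orient; ring.
  case: hs => es; rewrite es ?mulN1r ?mul1r in hy hz h1.
    apply: (ht t z y) => //; first by rewrite lt_def n.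
      by rewrite e1; lra.
    by rewrite e1; lra.
  apply: (ht t y z) => //; try lra.
  by rewrite e1 oppr_gt0 lt_neqAle n; lra.
have tp : t != p by apply: contraNneq pY => <-.
have h2 := orient_parallel y e.
have d1 := dot_gt0 tp; have d2 := hd _ _ mt mz e.
have h3 : 0 < s * orient p z y by move: hz; rewrite /orient; lra.
have := mulr_gt0 d1 h3; rewrite mulrCA h2 mulrCA.
have h4 : s * orient p t y <= 0 by lra.
by have := mulr_ge0_le0 d2 h4; lra.
Qed.

(** * Convex hulls and separation *)

(** Homogeneous form of the hull: [in_hull X p] is [cone X 1 p.1 p.2] by conversion. Dropping the
    total weight 1 permits sums, scaling, and induction on a list of weights. *)
Definition cone X (s m n : F) := exists w : point F -> F,
  (forall x, x \in X -> 0 <= w x) /\ \sum_(x <- X) w x = s /\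
  \sum_(x <- X) w x * x.1 = m /\ \sum_(x <- X) w x * x.2 = n.

Lemma cone_add X s m n s' m' n' :
  cone X s m n -> cone X s' m' n' -> cone X (s + s') (m + m') (n + n').
Proof.
move=> [w [w0 [<- [<- <-]]]] [w' [w0' [<- [<- <-]]]].
exists (fun x => w x + w' x); split.
  by move=> x xX; rewrite addr_ge0 ?w0 ?w0'.
by rewrite -!big_split; split=> //; split; apply: eq_bigr => x _ /=; rewrite mulrDl.
Qed.

Lemma cone_scale X k s m n : 0 <= k -> cone X s m n -> cone X (k * s) (k * m) (k * n).
Proof.
move=> k0 [w [w0 [<- [<- <-]]]]; exists (fun x => k * w x); split.
  by move=> x xX; rewrite mulr_ge0 ?w0.
by rewrite !mulr_sumr; split=> //; split; apply: eq_bigr => x _ /=; rewrite mulrA.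
Qed.

Lemma cone_eq X s m n s' m' n' :
  cone X s m n -> s = s' -> m = m' -> n = n' -> cone X s' m' n'.
Proof. by move=> h <- <- <-. Qed.

Lemma cone0 X : cone X 0 0 0.
Proof.
by exists (fun=> 0); split=> //; do !split; apply: big1 => x _; rewrite ?mul0r.
Qed.

Lemma in_hull_mem X p : uniq X -> p \in X -> in_hull X p.
Proof.
move=> uX pX; exists (fun x => (x == p)%:R); split.
  by move=> x _; rewrite ler0n.
have e (f : point F -> F) : \sum_(x <- X) (x == p)%:R * f x = f p.
  rewrite (bigD1_seq p) //= eqxx mul1r big1 ?addr0 // => x /negbTE ->.
  by rewrite mul0r.
split; last by split; apply: e.
by rewrite -[RHS](e (fun=> 1)); apply: eq_bigr => x _; rewrite mulr1.
Qed.

Lemma in_hull_trans X Y p :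
  (forall x, x \in Y -> in_hull X x) -> in_hull Y p -> in_hull X p.
Proof.
move=> hY [w [w0 [w1 [wx wy]]]]; rewrite /in_hull -w1 -wx -wy {w1 wx wy}.
change (cone X (\sum_(x <- Y) w x) (\sum_(x <- Y) w x * x.1) (\sum_(x <- Y) w x * x.2)).
elim: Y w0 hY => [|y Y IH] w0 hY; first by rewrite !big_nil; apply: cone0.
rewrite !big_cons; apply: cone_add; last first.
  by apply: IH => x xY; [apply: w0|apply: hY]; rewrite inE xY orbT.
rewrite -[X in cone _ X]mulr1; apply: cone_scale; first by rewrite w0 ?mem_head.
by apply: hY; rewrite mem_head.
Qed.

Definition lerp p q (t : F) : point F := (p.1 + t * (q.1 - p.1), p.2 + t * (q.2 - p.2)).

Lemma orient_lerp a b p q t :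
  orient a b (lerp p q t) = (1 - t) * orient a b p + t * orient a b q.
Proof. rewrite /orient /lerp /=; ring. Qed.

Lemma in_hull_lerp X p q t : 0 <= t <= 1 -> in_hull X p -> in_hull X q ->
  in_hull X (lerp p q t).
Proof.
move=> /andP [t0 t1] hp hq.
have t1' : 0 <= 1 - t by lra.
by apply: (cone_eq (cone_add (cone_scale t1' hp) (cone_scale t0 hq))); rewrite /=; ring.
Qed.

Lemma in_hull_affine_gt0 X p (k l m : F) :
  (forall x, x \in X -> 0 < k * x.1 + l * x.2 + m) -> in_hull X p ->
  0 < k * p.1 + l * p.2 + m.
Proof.
move=> hX [w [w0 [w1 [<- <-]]]].
have e : k * \sum_(x <- X) w x * x.1 + l * \sum_(x <- X) w x * x.2 + m =
   \sum_(x <- X) w x * (k * x.1 + l * x.2 + m).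
  rewrite -[m in LHS]mulr1 -w1 !mulr_sumr -!big_split /=.
  by apply: eq_bigr => x _; ring.
have g0 : 0 <= \sum_(x <- X) w x * (k * x.1 + l * x.2 + m).
  by rewrite big_seq sumr_ge0 // => x xX; rewrite mulr_ge0 ?w0 // ltW // hX.
rewrite e lt_def g0 andbT; apply/eqP => s0.
have : (\sum_(x <- X) w x * (k * x.1 + l * x.2 + m)) == 0 by rewrite s0.
rewrite big_seq psumr_eq0; last first.
  by move=> x xX; rewrite mulr_ge0 ?w0 // ltW // hX.
move=> /allP h; have : \sum_(x <- X) w x = 0.
  rewrite big_seq; apply: big1 => x xX; have /implyP := h _ xX.
  move=> /(_ xX); rewrite mulf_eq0 => /orP [/eqP //|].
  by move=> /eqP e0; have := hX _ xX; rewrite e0 ltxx.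
by rewrite w1 => /eqP; rewrite oner_eq0.
Qed.

Lemma in_hull_orient_gt0 X a b p :
  (forall x, x \in X -> 0 < orient a b x) -> in_hull X p -> 0 < orient a b p.
Proof.
have e x : orient a b x =
    (a.2 - b.2) * x.1 + (b.1 - a.1) * x.2 + ((b.2 - a.2) * a.1 - (b.1 - a.1) * a.2).
  by rewrite /orient; ring.
by move=> h; rewrite e; apply: in_hull_affine_gt0 => x xX; rewrite -e h.
Qed.

Lemma in_hull_orient_ge0 X a b p :
  (forall x, x \in X -> 0 <= orient a b x) -> in_hull X p -> 0 <= orient a b p.
Proof.
have e x : orient a b x =
    (a.2 - b.2) * x.1 + (b.1 - a.1) * x.2 + ((b.2 - a.2) * a.1 - (b.1 - a.1) * a.2).
  by rewrite /orient; ring.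
move=> h hp; rewrite leNgt; apply/negP => lt0.
(* A negative value at [p], subtracted from the functional, would leave it positive on [X] but zero
   at [p]. *)
have := @in_hull_affine_gt0 X p (a.2 - b.2) (b.1 - a.1)
   ((b.2 - a.2) * a.1 - (b.1 - a.1) * a.2 - orient a b p) _ hp.
rewrite addrA -e subrr ltxx => H; suff : false by []; apply: H => x xX.
by rewrite addrA -e; have := h _ xX; lra.
Qed.

Lemma between_lerp a b p : a != p -> orient p a b = 0 -> dot p a b < 0 ->
  exists2 k, 0 <= k <= 1 & p = lerp a b k.
Proof.
move=> ap e d.
have d1 := dot_gt0 ap.
(* The ratio in which [p] divides the segment, with both distances multiplied by the distance from
   [p] to [a]. *)
exists (dot p a a / (dot p a a - dot p a b)).
  by rewrite divr_ge0 ?ler_pdivrMr ?mul1r; lra.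
have dn : dot p a a - dot p a b != 0 by rewrite gt_eqF //; lra.
apply: injective_projections => /=.
  apply: (mulfI dn); rewrite mulrDr mulrA mulrCA mulfV // mulr1.
  have : - (a.2 - p.2) * orient p a b = 0 by rewrite e mulr0.
  by rewrite /orient /dot; lra.
apply: (mulfI dn); rewrite mulrDr mulrA mulrCA mulfV // mulr1.
have : (a.1 - p.1) * orient p a b = 0 by rewrite e mulr0.
by rewrite /orient /dot; lra.
Qed.

Lemma in_hull_bary X a b c p (ka kb kc : F) : uniq X -> a \in X -> b \in X -> c \in X ->
  0 <= ka -> 0 <= kb -> 0 <= kc -> ka + kb + kc = 1 ->
  ka * a.1 + kb * b.1 + kc * c.1 = p.1 -> ka * a.2 + kb * b.2 + kc * c.2 = p.2 ->
  in_hull X p.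
Proof.
move=> uX aX bX cX ka0 kb0 kc0 k1 e1 e2.
have := cone_add (cone_add
   (cone_scale ka0 (in_hull_mem uX aX))
   (cone_scale kb0 (in_hull_mem uX bX)))
   (cone_scale kc0 (in_hull_mem uX cX)).
by rewrite !mulr1 k1 e1 e2.
Qed.

Lemma triangle_weights a b c p :
  0 <= orient a b p -> 0 <= orient b c p -> 0 <= orient c a p -> 0 < orient a b c ->
  exists ka kb kc : F, [/\ [/\ 0 <= ka, 0 <= kb & 0 <= kc], ka + kb + kc = 1,
    ka * a.1 + kb * b.1 + kc * c.1 = p.1 & ka * a.2 + kb * b.2 + kc * c.2 = p.2].
Proof.
move=> h1 h2 h3 h.
have hn : orient a b c != 0 by rewrite gt_eqF.
have hi : 0 <= (orient a b c)^-1 by rewrite invr_ge0 ltW.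
exists (orient b c p / orient a b c), (orient c a p / orient a b c),
  (orient a b p / orient a b c); rewrite !mulr_ge0 //; split=> //.
- by rewrite -!mulrDl -(orient_sum a b c p) addrC addrA divff // orient_sum.
- apply: (mulfI hn); rewrite !mulrDr ![_ * (_ / _ * _)]mulrA ![orient a b c * (_ / _)]mulrC !divfK //.
  by rewrite /orient; ring.
- apply: (mulfI hn); rewrite !mulrDr ![_ * (_ / _ * _)]mulrA ![orient a b c * (_ / _)]mulrC !divfK //.
  by rewrite /orient; ring.
Qed.

(** The tangent from [p] through [t] leaves [Y] on one closed side, and its points on the line lie
    on the ray of [t]. Rotating the line slightly, by adding a small multiple [e] of [dot p t],
    makes the inequality strict; finiteness of [Y] supplies [e]. *)
Lemma strict_half_plane p Y : p \notin Y ->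
  (forall a b, a \in Y -> b \in Y -> orient p a b = 0 -> 0 <= dot p a b) ->
  (forall a b c, a \in Y -> b \in Y -> c \in Y ->
     0 < orient p a b -> 0 < orient p b c -> 0 < orient p c a -> False) ->
  exists k l : F, forall x, x \in Y -> 0 < k * (x.1 - p.1) + l * (x.2 - p.2).
Proof.
have [->|Yn] := eqVneq Y [::]; first by exists 0, 0.
move=> pY hd ht.
have [t tY tmin] := @tangent_point 1 p Y (or_introl erefl) Yn pY hd ht.
have tp : t != p by apply: contraNneq pY => <-.
have hx x : x \in Y -> 0 <= orient p t x /\ (orient p t x = 0 -> 0 < dot p t x).
  move=> xY; split; first by have := tmin _ xY; rewrite mul1r.
  move=> e; rewrite lt_def hd // andbT; apply/eqP => d0.
  have xp : x != p by apply: contraNneq pY => <-.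
  have := dot_gt0 tp; have := dot_gt0 xp => d1 d2.
  have := mulr_gt0 d1 d2.
  (* Lagrange's identity: [dot] and [orient] cannot both vanish. *)
  have -> : dot p x x * dot p t t = dot p t x ^+ 2 + orient p t x ^+ 2.
    by rewrite /dot /orient; ring.
  by rewrite d0 e expr0n addr0 ltxx.
have [e e0 he] : exists2 e : F, 0 < e & forall x, x \in Y -> 0 < orient p t x + e * dot p t x.
  elim: Y hx {pY hd ht tY tmin Yn} => [|y Y IH] hx; first by exists 1.
  have [x xY|e e0 he] := IH; first by apply: hx; rewrite inE xY orbT.
  have [y0 y1] : 0 <= orient p t y /\ (orient p t y = 0 -> 0 < dot p t y).
    by apply: hx; rewrite mem_head.
  have [e' e'0 [le he']] : exists2 e', 0 < e' & e' <= e /\ 0 < orient p t y + e' * dot p t y.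
    have [d0|d0] := leP 0 (dot p t y).
      exists e => //; split=> //.
      have := mulr_ge0 (ltW e0) d0.
      have [z|z] := eqVneq (orient p t y) 0.
        by have := mulr_gt0 e0 (y1 z); lra.
      by have := y0; rewrite le_eqVlt eq_sym (negbTE z) /=; lra.
    have y2 : 0 < orient p t y.
      rewrite lt_def y0 andbT; apply/eqP => z; have := y1 z; lra.
    have q0 : 0 < orient p t y / (- dot p t y + - dot p t y).
      by rewrite divr_gt0 //; lra.
    (* The doubled denominator lets the negative term use up at most half of [orient p t y]. *)
    exists (Num.min e (orient p t y / (- dot p t y + - dot p t y))).
      by rewrite lt_min e0.
    rewrite ge_min lexx; split=> //.
    set m := Num.min _ _.
    have mle : m <= orient p t y / (- dot p t y + - dot p t y) by rewrite ge_min lexx orbT.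
    have : m * (- dot p t y + - dot p t y) <= orient p t y.
      by rewrite -ler_pdivlMr //; lra.
    by lra.
  exists e' => // x; rewrite inE => /orP [/eqP -> //|xY].
  have h1 := he _ xY; have [h2 _] : 0 <= orient p t x /\ (orient p t x = 0 -> 0 < dot p t x).
    by apply: hx; rewrite inE xY orbT.
  (* Shrinking [e] to [e'] is harmless: [e] times the new value is [e'] times the old value plus
     [(e - e') * orient p t x]. *)
  rewrite -(pmulr_rgt0 _ e0).
  have := mulr_gt0 e'0 h1; have : 0 <= (e - e') * orient p t x by rewrite mulr_ge0 // subr_ge0.
  by lra.
exists (- (t.2 - p.2) + e * (t.1 - p.1)), ((t.1 - p.1) + e * (t.2 - p.2)) => x xY.
by have := he _ xY; rewrite /orient /dot; lra.
Qed.

(** Obtained from separation: if all three alternatives fail, [strict_half_plane] gives an affine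
    functional positive on [X] and zero at [p]. *)
Lemma caratheodory X p : in_hull X p ->
  [\/ p \in X,
      exists a b, [/\ a \in X, b \in X, orient p a b = 0 & dot p a b < 0] |
      exists a b c, [/\ a \in X, b \in X, c \in X &
        [/\ 0 < orient a b p, 0 < orient b c p & 0 < orient c a p]]].
Proof.
move=> hp; apply: NNPP => H.
have pX : p \notin X by apply/negP => pX; apply: H; constructor 1.
have [| |k [l h]] := strict_half_plane pX.
- move=> a b aX bX e; rewrite leNgt; apply/negP => d; apply: H; constructor 2.
  by exists a, b.
- move=> a b c aX bX cX h1 h2 h3; apply: H; constructor 3; exists a, b, c; split=> //.
  by split; rewrite -orientC.
have := @in_hull_affine_gt0 X p k l (- k * p.1 - l * p.2) _ hp.
have e (q : point F) : k * q.1 + l * q.2 + (- k * p.1 - l * p.2) = k * (q.1 - p.1) + l * (q.2 - p.2).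
  by ring.
rewrite e !subrr !mulr0 addr0 ltxx => K; suff : false by []; apply: K => x xX.
by rewrite e h.
Qed.

Lemma separating_functional X p : uniq X -> ~ in_hull X p ->
  exists k l : F, forall x, x \in X -> 0 < k * (x.1 - p.1) + l * (x.2 - p.2).
Proof.
move=> uX hp.
have pX : p \notin X by apply/negP => pX; apply: hp; apply: in_hull_mem.
apply: strict_half_plane => // [a b aX bX e|a b c aX bX cX h1 h2 h3].
  rewrite leNgt; apply/negP => d; apply: hp.
  have ap : a != p by apply: contraNneq pX => <-.
  have [k k01 ->] := between_lerp ap e d.
  by apply: in_hull_lerp => //; apply: in_hull_mem.
rewrite !(orientC p) in h1 h2 h3; apply: hp.
have h : 0 < orient a b c by rewrite -(orient_sum a b c p); lra.
have [ka [kb [kc [[? ? ?] ? ? ?]]]] := triangle_weights (ltW h1) (ltW h2) (ltW h3) h.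
by apply: (@in_hull_bary _ a b c _ ka kb kc).
Qed.

(** * Hull edges *)

Lemma size_gt0_mem X : (0 < size X)%N -> exists x, x \in X.
Proof. by case: X => // x X _; exists x; rewrite mem_head. Qed.

Lemma mem_neq_nil X x : x \in X -> X != [::].
Proof. by case: X. Qed.

Lemma argmin_seq (f : point F -> F) X : X != [::] ->
  exists2 t, t \in X & forall x, x \in X -> f t <= f x.
Proof.
elim: X => // y X IH _; have [->|Xn] := eqVneq X [::].
  by exists y; rewrite ?mem_head // => x; rewrite inE => /eqP ->.
have [t tX ht] := IH Xn; have [le|lt] := leP (f t) (f y).
  exists t; first by rewrite inE tX orbT.
  by move=> x; rewrite inE => /orP [/eqP ->|/ht].
exists y; first by rewrite mem_head.
by move=> x; rewrite inE => /orP [/eqP -> //|/ht]; apply: le_trans; apply: ltW.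
Qed.

(** Separating [X] from [Y] amounts to separating the origin from the set [D] of differences. An
    obstruction, a segment or triangle of [D] around the origin, has weights that produce the same
    point from [X] and from [Y]. *)
Lemma common_point X Y : uniq X -> uniq Y -> X != [::] -> Y != [::] ->
  (forall p, p \in X -> p \notin Y) -> ~ lin_separable X Y ->
  exists2 z, in_hull X z & in_hull Y z.
Proof.
move=> uX uY Xn Yn dis nsep; apply: NNPP => H; apply: nsep.
pose D := [seq ((x.1 - y.1, x.2 - y.2) : point F) | x <- X, y <- Y].
have [|||k [l h]] := @strict_half_plane (0, 0) D.
- apply/negP => /allpairsP [[x y] /= [xX yY [e1 e2]]].
  have /negP := dis _ xX; apply.
  by rewrite (_ : x = y) // (surjective_pairing x) (surjective_pairing y); congr pair; lra.
- move=> _ _ /allpairsP [[x y] /= [xX yY ->]] /allpairsP [[x' y'] /= [xX' yY' ->]] e.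
  rewrite leNgt; apply/negP => d; apply: H.
  have [|k k01 [e1 e2]] := between_lerp _ e d.
    apply/eqP => -[e1 e2]; move: d.
    by rewrite /dot /= e1 e2 !subrr !mul0r addr0 ltxx.
  exists (lerp x x' k); first by apply: in_hull_lerp => //; apply: in_hull_mem.
  rewrite /= in e1 e2.
  have -> : lerp x x' k = lerp y y' k.
    by clear - e1 e2; apply: injective_projections => /=; lra.
  by apply: in_hull_lerp => //; apply: in_hull_mem.
- move=> _ _ _ /allpairsP [[x y] /= [xX yY ->]] /allpairsP [[x' y'] /= [xX' yY' ->]]
    /allpairsP [[x'' y''] /= [xX'' yY'' ->]]; rewrite !(orientC (0, 0)).
  set a := (x.1 - y.1, _); set b := (x'.1 - y'.1, _); set c := (x''.1 - y''.1, _).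
  move=> h1 h2 h3; apply: H.
  have h : 0 < orient a b c by rewrite -(orient_sum a b c (0, 0)); lra.
  have [ka [kb [kc [[ka0 kb0 kc0] e1 e2 e3]]]] := triangle_weights (ltW h1) (ltW h2) (ltW h3) h.
  rewrite /a /b /c /= in e2 e3.
  exists (ka * x.1 + kb * x'.1 + kc * x''.1, ka * x.2 + kb * x'.2 + kc * x''.2).
    by apply: (in_hull_bary uX xX xX' xX'' ka0 kb0 kc0).
  by apply: (in_hull_bary uY yY yY' yY'' ka0 kb0 kc0) => //=; lra.
have [x0 x0X hx] := argmin_seq (fun x => k * x.1 + l * x.2) Xn.
have [y0 y0Y hy] := argmin_seq (fun x => - (k * x.1 + l * x.2)) Yn.
have h' x y : x \in X -> y \in Y -> k * y.1 + l * y.2 < k * x.1 + l * x.2.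
  move=> xX yY; have := h (x.1 - y.1, x.2 - y.2) => /=.
  by rewrite !subr0 => /(_ (allpairs_f _ xX yY)); lra.
(* The threshold is halfway between the minimum on [X], at [x0], and the maximum on [Y], at [y0]. *)
exists k, l, (- (k * x0.1 + l * x0.2 + (k * y0.1 + l * y0.2)) / 2); split.
  have := h' _ _ x0X y0Y; have [->|] := eqVneq k 0; last by left.
  by have [->|] := eqVneq l 0; [rewrite !mul0r addr0 ltxx|right].
have := h' _ _ x0X y0Y => h0; split=> z zX.
  by have := hx _ zX; lra.
by have := hy _ zX; lra.
Qed.

(** Directed form of [hull_edge], counterclockwise with [X] on the left. In a two-point set both
    directions qualify. *)
Definition edge X u v : Prop :=
  [/\ u \in X, v \in X, u != v & forall w, w \in X -> 0 <= orient u v w].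

Lemma orient_eq0_mem X a b c : general_position X -> a \in X -> b \in X -> c \in X ->
  a != b -> orient a b c = 0 -> c = a \/ c = b.
Proof.
move=> gp aX bX cX ab e; have [->|ca] := eqVneq c a; first by left.
have [->|cb] := eqVneq c b; first by right.
by have := gp _ _ _ aX bX cX ab; rewrite eq_sym cb eq_sym ca e eqxx => /(_ isT isT).
Qed.

Lemma orient_neq0 X a b c : general_position X -> a \in X -> b \in X -> c \in X ->
  a != b -> c != a -> c != b -> orient a b c != 0.
Proof.
by move=> gp aX bX cX ab ca cb; apply: gp => //; rewrite eq_sym.
Qed.

(** The two tangents from [t] to the remaining points are its outgoing and incoming edges. Three
    points cannot surround [t]: a positive combination of their nonnegative values would vanish,
    making the functional zero on two independent directions. *)
Lemma extreme_edges X t x0 (k l : F) : general_position X -> t \in X -> x0 \in X -> x0 != t ->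
  k != 0 \/ l != 0 ->
  (forall x, x \in X -> 0 <= k * (x.1 - t.1) + l * (x.2 - t.2)) ->
  (exists y, edge X t y) /\ (exists w, edge X w t).
Proof.
move=> gp tX x0X x0t kl h.
pose Y := [seq x <- X | x != t].
have YX x : x \in Y -> x \in X /\ x != t by rewrite mem_filter => /andP [].
have Yn : Y != [::].
  by have : x0 \in Y; [rewrite mem_filter x0t|case: Y {YX}].
have tY : t \notin Y by rewrite mem_filter eqxx.
have hd a b : a \in Y -> b \in Y -> orient t a b = 0 -> 0 <= dot t a b.
  move=> /YX [aX at0] /YX [bX bt] e; rewrite eq_sym in at0.
  have [E|->] := orient_eq0_mem gp tX aX bX at0 e; first by rewrite E eqxx in bt.
  by apply: ltW; apply: dot_gt0; rewrite eq_sym.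
have ht a b c : a \in Y -> b \in Y -> c \in Y ->
     0 < orient t a b -> 0 < orient t b c -> 0 < orient t c a -> False.
  move=> /YX [aX _] /YX [bX _] /YX [cX _] h1 h2 h3.
  have ha := h _ aX; have hb := h _ bX; have hc := h _ cX.
  set fa := k * (a.1 - _) + _ in ha; set fb := k * (b.1 - _) + _ in hb.
  set fc := k * (c.1 - _) + _ in hc.
  have E : orient t b c * fa + orient t c a * fb + orient t a b * fc = 0.
    by rewrite /fa /fb /fc /orient; ring.
  have ga := mulr_ge0 (ltW h2) ha; have gb := mulr_ge0 (ltW h3) hb.
  have gc := mulr_ge0 (ltW h1) hc.
  have za : orient t b c * fa = 0 by lra.
  have zb : orient t c a * fb = 0 by lra.
  move/eqP: za; rewrite mulf_eq0 gt_eqF //= => /eqP za.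
  move/eqP: zb; rewrite mulf_eq0 gt_eqF //= => /eqP zb.
  have nz : orient t a b != 0 by rewrite gt_eqF.
  have /eqP : k * orient t a b = fa * (b.2 - t.2) - fb * (a.2 - t.2).
    by rewrite /fa /fb /orient; ring.
  rewrite za zb !mul0r subrr mulf_eq0 (negbTE nz) orbF => /eqP k0.
  have /eqP : l * orient t a b = - fa * (b.1 - t.1) + fb * (a.1 - t.1).
    by rewrite /fa /fb /orient; ring.
  rewrite za zb oppr0 !mul0r addr0 mulf_eq0 (negbTE nz) orbF => /eqP l0.
  by case: kl; rewrite ?k0 ?l0 eqxx.
split.
  have [y yY hy] := tangent_point (or_introl (erefl (1 : F))) Yn tY hd ht.
  have [yX yt] := YX _ yY; exists y; split=> //; first by rewrite eq_sym.
  move=> w wX; have [->|wt] := eqVneq w t; first by rewrite orient_l.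
  by have := hy w; rewrite mem_filter wt wX mul1r; apply.
have [y yY hy] := tangent_point (or_intror (erefl (-1 : F))) Yn tY hd ht.
have [yX yt] := YX _ yY; exists y; split=> //.
move=> w wX; have [->|wt] := eqVneq w t; first by rewrite orient_r.
by rewrite orientN; have := hy w; rewrite mem_filter wt wX mulN1r; apply.
Qed.

Lemma edge_functional u v x t : orient u v t = 0 ->
  orient u v x = - (v.2 - u.2) * (x.1 - t.1) + (v.1 - u.1) * (x.2 - t.2).
Proof. by rewrite /orient => h; lra. Qed.

Lemma edge_coef_neq0 u v : u != v -> - (v.2 - u.2) != 0 \/ v.1 - u.1 != 0.
Proof.
move=> uv; have [e1|] := eqVneq (v.1 - u.1) 0; last by right.
left; rewrite oppr_eq0; apply: contra uv; rewrite subr_eq0 => /eqP e2.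
by rewrite (surjective_pairing u) (surjective_pairing v) e2 (_ : v.1 = u.1) //; lra.
Qed.

Lemma edge_next X u v : general_position X -> edge X u v -> exists y, edge X v y.
Proof.
move=> gp [uX vX uv h].
have [|ex _] := @extreme_edges X v u (- (v.2 - u.2)) (v.1 - u.1) gp vX uX uv (edge_coef_neq0 uv).
  by move=> x xX; rewrite -edge_functional ?orient_r ?h.
exact: ex.
Qed.

Lemma edge_prev X u v : general_position X -> edge X u v -> exists w, edge X w u.
Proof.
move=> gp [uX vX uv h]; have vu : v != u by rewrite eq_sym.
have [|_ ex] := @extreme_edges X u v (- (v.2 - u.2)) (v.1 - u.1) gp uX vX vu (edge_coef_neq0 uv).
  by move=> x xX; rewrite -edge_functional ?orient_l ?h.
exact: ex.
Qed.

Lemma mem_pair_size X a b : uniq X -> (forall x, x \in X -> x = a \/ x = b) -> (size X <= 2)%N.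
Proof.
move=> uX h; apply: (@uniq_leq_size _ X [:: a; b] uX) => x /h [] ->;
  by rewrite !inE eqxx ?orbT.
Qed.

(** Let [t] minimise a functional whose values on [X] exceed the one at [p]. If [p] were on the
    inner side of both edges at [t], it would lie in the angle they span, where the functional is at
    least its value at [t]. *)
Lemma hull_half_planes X p : uniq X -> general_position X -> (2 < size X)%N ->
  in_hull X p \/ exists x y, edge X x y /\ orient x y p < 0.
Proof.
move=> uX gp sX; have [hp|hp] := classic (in_hull X p); [by left|right].
have [k [l h]] := separating_functional uX hp.
have Xn : X != [::] by case: X sX {uX gp hp h}.
have [t tX ht] := argmin_seq (fun x => k * x.1 + l * x.2) Xn.
have kl : k != 0 \/ l != 0.
  have := h _ tX; have [->|] := eqVneq k 0; last by left.
  by have [->|] := eqVneq l 0; [rewrite !mul0r addr0 ltxx|right].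
have [x0 x0X x0t] : exists2 x0, x0 \in X & x0 != t.
  apply: NNPP => H; suff : (size X <= 2)%N by rewrite leqNgt sX.
  apply: (@mem_pair_size X t t uX) => x xX; left; apply/eqP.
  by apply/negPn/negP => xt; apply: H; exists x.
have [|[y1 [_ y1X ty1 h1]] [y2 [y2X _ y2t h2]]] := extreme_edges gp tX x0X x0t kl.
  by move=> x xX; have := ht _ xX; lra.
have nz : orient t y1 y2 != 0.
  apply/eqP => e; have [E|E] := orient_eq0_mem gp tX y1X y2X ty1 e.
    by rewrite E eqxx in y2t.
  suff : (size X <= 2)%N by rewrite leqNgt sX.
  apply: (@mem_pair_size X t y1 uX) => x xX.
  apply: (orient_eq0_mem gp tX y1X xX ty1).
  by have := h1 _ xX; have := h2 _ xX; rewrite E orientN; lra.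
have ps : 0 < orient t y1 y2 by rewrite lt_def nz h1.
have [g1|g1] := ltP (orient t y1 p) 0; first by exists t, y1.
have [g2|g2] := ltP (orient y2 t p) 0; first by exists y2, t.
have m1 : 0 <= k * (y1.1 - t.1) + l * (y1.2 - t.2) by have := ht _ y1X; lra.
have m2 : 0 <= k * (y2.1 - t.1) + l * (y2.2 - t.2) by have := ht _ y2X; lra.
have := mulr_ge0 g2 m1; have := mulr_ge0 g1 m2; have := mulr_gt0 ps (h _ tX).
by rewrite /orient; lra.
Qed.

Lemma hull_edge_visible X p : uniq X -> general_position X -> (1 < size X)%N ->
  (forall x y, x \in X -> y \in X -> x != y -> orient x y p != 0) ->
  ~ in_hull X p -> exists x y, edge X x y /\ orient x y p < 0.
Proof.
move=> uX gp sX np hp.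
have [s3|s2] := ltnP 2 (size X); first by case: (hull_half_planes p uX gp s3).
case: X uX sX s2 np {hp gp} => [|x [|y [|]]] //=; rewrite inE andbT => xy _ _ np.
have mx : x \in [:: x; y] by rewrite mem_head.
have my : y \in [:: x; y] by rewrite !inE eqxx orbT.
have := np _ _ mx my xy; have [g|g|//] := ltgtP (orient x y p) 0 => _.
  exists x, y; split=> //; split=> // w.
  by rewrite !inE => /orP [] /eqP ->; rewrite ?orient_l ?orient_r.
exists y, x; split; last by rewrite orientN; lra.
split=> //; first by rewrite eq_sym.
by move=> w; rewrite !inE => /orP [] /eqP ->; rewrite ?orient_l ?orient_r.
Qed.

(** Finite search for the exit point: whenever the next half-plane excludes the current point, move
    back towards [z] up to its boundary line. Convexity keeps the earlier half-planes satisfied. *)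
Lemma exit_half_planes (E : seq (point F * point F)) z b :
  (forall e, e \in E -> 0 <= orient e.1 e.2 z) ->
  exists2 t : F, 0 <= t <= 1 & (forall e, e \in E -> 0 <= orient e.1 e.2 (lerp z b t)) /\
    (t = 1 \/ exists2 e, e \in E & orient e.1 e.2 (lerp z b t) = 0).
Proof.
elim: E => [|e E IH] h.
  by exists 1; [rewrite lexx ler01|split=> //; left].
have [|t /andP [t0 t1] [h1 h2]] := IH; first by move=> f fE; apply: h; rewrite inE fE orbT.
have [g|g] := leP 0 (orient e.1 e.2 (lerp z b t)).
  exists t; first by rewrite t0.
  split; first by move=> f; rewrite inE => /orP [/eqP -> //|/h1].
  by case: h2 => [|[f fE f0]]; [left|right; exists f; rewrite // inE fE orbT].
have hz : 0 <= orient e.1 e.2 z by apply: h; rewrite mem_head.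
set A := orient e.1 e.2 z in hz; set B := orient _ _ _ in g.
have AB : 0 < A - B by lra.
pose s := A / (A - B).
have s0 : 0 <= s by rewrite divr_ge0 // ltW.
have s1 : s <= 1 by rewrite ler_pdivrMr // mul1r; lra.
have sE : s * (A - B) = A by rewrite /s divfK // gt_eqF.
have es f : orient f.1 f.2 (lerp z b (s * t)) =
    (1 - s) * orient f.1 f.2 z + s * orient f.1 f.2 (lerp z b t).
  by rewrite !orient_lerp; ring.
exists (s * t); first by rewrite mulr_ge0 //= mulr_ile1.
have ee : orient e.1 e.2 (lerp z b (s * t)) = 0 by rewrite es -/A -/B; lra.
split; last by right; exists e; rewrite // mem_head.
move=> f; rewrite inE => /orP [/eqP ->|fE]; first by rewrite ee.
rewrite es; have f0 : 0 <= orient f.1 f.2 z by apply: h; rewrite inE fE orbT.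
have s1' : 0 <= 1 - s by lra.
by have := mulr_ge0 s1' f0; have := mulr_ge0 s0 (h1 _ fE); lra.
Qed.

Lemma hull_exit X z b : uniq X -> general_position X -> (1 < size X)%N ->
  in_hull X z -> ~ in_hull X b ->
  exists t s s', [/\ 0 <= t <= 1, edge X s s', orient s s' (lerp z b t) = 0 &
    in_hull X (lerp z b t)].
Proof.
move=> uX gp sX hz hb.
have [s3|s2] := ltnP 2 (size X); last first.
  case: X uX sX s2 hz {hb gp} => [|x [|y [|]]] //=; rewrite inE andbT => xy _ _ hz.
  have z0 : lerp z b 0 = z by rewrite /lerp !mul0r !addr0 -surjective_pairing.
  (* The hull of two points is a segment, so [z] already lies on an edge and [t = 0] serves. *)
  exists 0, x, y; rewrite z0 lexx ler01; split=> //.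
    split=> //; rewrite ?mem_head ?inE ?eqxx ?orbT //.
    by move=> w; rewrite !inE => /orP [] /eqP ->; rewrite ?orient_l ?orient_r.
  apply/eqP; rewrite eq_le -oppr_ge0 -orientN !(in_hull_orient_ge0 _ hz) // => w;
    by rewrite !inE => /orP [] /eqP ->; rewrite ?orient_l ?orient_r.
pose E := [seq e <- [seq (x, y) | x <- X, y <- X] | (e.1 != e.2) &&
   all (fun w => 0 <= orient e.1 e.2 w) X].
have EP e : e \in E -> edge X e.1 e.2.
  rewrite mem_filter => /andP [/andP [ne /allP h] /allpairsP [[x y] /= [xX yX ee]]].
  by move: ne h; rewrite ee /=; split.
have [|t t01 [h1 h2]] := @exit_half_planes E z b.
  by move=> e /EP [_ _ _ h]; apply: in_hull_orient_ge0 hz.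
have ht : in_hull X (lerp z b t).
  case: (hull_half_planes (lerp z b t) uX gp s3) => // -[x [y [[xX yX xy h] g]]].
  have : (x, y) \in E.
    by rewrite mem_filter /= xy allpairs_f // andbT; apply/allP.
  by move=> /h1 /=; rewrite leNgt g.
case: h2 => [t1|[e /EP eE e0]]; last by exists t, e.1, e.2.
case: hb; move: ht; rewrite t1 /lerp (_ : (_, _) = b) // (surjective_pairing b) /=.
by congr pair; ring.
Qed.

Lemma edge_boundary X s s' p : edge X s s' -> orient s s' p = 0 -> in_hull X p ->
  on_hull_boundary X p.
Proof.
move=> [sX sX' ss h] p0 hp; split=> // -[e [e0 he]].
have N0 : 0 < dot s s' s' by apply: dot_gt0; rewrite eq_sym.
(* The point [q] is [p] moved outwards along the normal of the edge. As [t < 1] and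
   [t * (N + e) = e], the squared distance [t * (t * N)] is below [e]. *)
pose N := dot s s' s'; pose t := e / (N + e).
have Ne : 0 < N + e by rewrite addr_gt0.
have t0 : 0 < t by rewrite divr_gt0.
have tE : t * (N + e) = e by rewrite divfK // gt_eqF.
pose q : point F := (p.1 + t * (s'.2 - s.2), p.2 - t * (s'.1 - s.1)).
have hq : in_hull X q.
  apply: he => /=.
  have -> : (p.1 + t * (s'.2 - s.2) - p.1) ^+ 2 + (p.2 - t * (s'.1 - s.1) - p.2) ^+ 2 = t * (t * N).
    by rewrite /N /dot; ring.
  have t1 : t < 1 by rewrite ltr_pdivrMr // mul1r; rewrite -/N in N0; lra.
  have tN : 0 < t * N by rewrite mulr_gt0.
  have := mulr_gt0 t0 e0; have : t * (t * N) <= t * N by rewrite ler_piMl // ltW.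
  by lra.
have := in_hull_orient_ge0 h hq; rewrite leNgt => /negP; apply.
have -> : orient s s' q = orient s s' p - t * N by rewrite /orient /N /dot /q /=; ring.
by rewrite p0 sub0r oppr_lt0 mulr_gt0.
Qed.

Lemma hull_interior_triangle X a b c p : uniq X -> a \in X -> b \in X -> c \in X ->
  0 < orient a b p -> 0 < orient b c p -> 0 < orient c a p -> in_hull_interior X p.
Proof.
move=> uX aX bX cX h1 h2 h3.
have h : 0 < orient a b c by rewrite -(orient_sum a b c p); lra.
have nh : orient a b c != 0 by rewrite gt_eqF.
have [ab bc ac] := orient_neq nh.
have near x y : x != y -> 0 < orient x y p ->
    exists2 e : F, 0 < e & forall q, (q.1 - p.1) ^+ 2 + (q.2 - p.2) ^+ 2 < e -> 0 <= orient x y q.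
  move=> xy hp; have N0 : 0 < dot x y y by apply: dot_gt0; rewrite eq_sym.
  (* The squared distance from [p] to the line [x y]; [D2] below is Cauchy-Schwarz. *)
  exists (orient x y p ^+ 2 / dot x y y); first by rewrite divr_gt0 // exprn_gt0.
  move=> q; rewrite ltr_pdivlMr // => hq; rewrite leNgt; apply/negP => qn.
  pose D := orient x y p - orient x y q.
  have D2 : D ^+ 2 <= ((q.1 - p.1) ^+ 2 + (q.2 - p.2) ^+ 2) * dot x y y.
    rewrite -subr_ge0.
    have -> : ((q.1 - p.1) ^+ 2 + (q.2 - p.2) ^+ 2) * dot x y y - D ^+ 2 =
       ((q.1 - p.1) * (y.1 - x.1) + (q.2 - p.2) * (y.2 - x.2)) ^+ 2.
      by rewrite /D /dot /orient; ring.
    exact: sqr_ge0.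
  have : D ^+ 2 < orient x y p ^+ 2 by apply: le_lt_trans D2 hq.
  by rewrite ltr_pXn2r ?nnegrE /D //; lra.
have [e1 e10 he1] := near _ _ ab h1.
have [e2 e20 he2] := near _ _ bc h2.
have [|e3 e30 he3] := near c a _ h3; first by rewrite eq_sym.
exists (Num.min e1 (Num.min e2 e3)); split; first by rewrite !lt_min e10 e20.
move=> q; rewrite !lt_min => /and3P [/he1 g1 /he2 g2 /he3 g3].
have [ka [kb [kc [[? ? ?] ? ? ?]]]] := triangle_weights g1 g2 g3 h.
by apply: (@in_hull_bary _ a b c _ ka kb kc).
Qed.

(** * Convex quadrilaterals and crossing segments *)

Definition ccw4 a b c d : Prop :=
  [/\ 0 < orient a b c, 0 < orient b c d, 0 < orient c d a & 0 < orient d a b].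

Definition in_quad a b c d p : bool :=
  [&& 0 < orient a b p, 0 < orient b c p, 0 < orient c d p & 0 < orient d a p].

Definition in_tri a b c p : Prop :=
  [/\ 0 < orient a b p, 0 < orient b c p & 0 < orient c a p].

Lemma in_quadP a b c d p : reflect (in_quad_interior a b c d p) (in_quad a b c d p).
Proof. by apply: (iffP and4P) => -[]; split. Qed.

Lemma ccw4_rot a b c d : ccw4 a b c d -> ccw4 b c d a.
Proof. by case=> h1 h2 h3 h4; split. Qed.

Lemma in_quad_rot a b c d p : in_quad b c d a p = in_quad a b c d p.
Proof. by rewrite /in_quad; do 4![case: (0 < _)]. Qed.

Lemma in_tri_rot a b c p : in_tri a b c p -> in_tri b c a p.
Proof. by case=> h1 h2 h3; split. Qed.

Lemma in_tri_gt0 a b c p : in_tri a b c p -> 0 < orient a b c.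
Proof. by case=> h1 h2 h3; rewrite -(orient_sum a b c p); lra. Qed.

Lemma in_tri_orient_gt0 a b c p x y : in_tri a b c p ->
  0 <= orient x y a -> 0 <= orient x y b -> 0 <= orient x y c ->
  0 < orient x y a + orient x y b + orient x y c -> 0 < orient x y p.
Proof.
move=> T; have h := in_tri_gt0 T; case: T => h1 h2 h3 ga gb gc gs.
rewrite -(pmulr_rgt0 _ h) bary.
have [m1 m2 m3] := And3 (mulr_ge0 (ltW h2) ga) (mulr_ge0 (ltW h3) gb) (mulr_ge0 (ltW h1) gc).
have [g|g] := ltP 0 (orient x y a); first by have := mulr_gt0 h2 g; lra.
have [g'|g'] := ltP 0 (orient x y b); first by have := mulr_gt0 h3 g'; lra.
have g'' : 0 < orient x y c by lra.
by have := mulr_gt0 h1 g''; lra.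
Qed.

(** The diagonal [a c] cuts the quadrilateral into two triangles; the weights are the barycentric
    coordinates in the one that contains [p]. *)
Lemma quad_half_weights a b c d p : ccw4 a b c d -> in_quad a b c d p ->
  exists ka kb kc kd : F, [/\ 0 < ka, 0 <= kb, 0 < kc, 0 <= kd &
    forall x y, (ka + kb + kc + kd) * orient x y p =
      ka * orient x y a + kb * orient x y b + kc * orient x y c + kd * orient x y d].
Proof.
move=> [h1 h2 h3 h4] /and4P [g1 g2 g3 g4].
have [g|g] := leP 0 (orient c a p).
  exists (orient b c p), (orient c a p), (orient a b p), 0; split=> // x y.
  rewrite mul0r !addr0 -bary -(orient_sum a b c p); ring.
exists (orient c d p), 0, (orient d a p), (orient a c p); split=> //.
  by rewrite orientN; lra.
by move=> x y; rewrite /orient; ring.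
Qed.

(** Adding the decompositions for the two diagonals makes all four weights positive. *)
Lemma quad_weights a b c d p : ccw4 a b c d -> in_quad a b c d p ->
  exists ka kb kc kd : F, [/\ 0 < ka, 0 < kb, 0 < kc, 0 < kd &
    forall x y, (ka + kb + kc + kd) * orient x y p =
      ka * orient x y a + kb * orient x y b + kc * orient x y c + kd * orient x y d].
Proof.
move=> Q I; have [ka [kb [kc [kd [a0 b0 c0 d0 h]]]]] := quad_half_weights Q I.
rewrite -in_quad_rot in I.
have [lb [lc [ld [la [b1 c1 d1 a1 h']]]]] := quad_half_weights (ccw4_rot Q) I.
exists (ka + la), (kb + lb), (kc + lc), (kd + ld); split; try lra.
by move=> x y; have := h x y; have := h' x y; lra.
Qed.

Lemma in_quad_orient_gt0 a b c d p x y : ccw4 a b c d -> in_quad a b c d p ->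
  0 <= orient x y a -> 0 <= orient x y b -> 0 <= orient x y c -> 0 <= orient x y d ->
  0 < orient x y a + orient x y b + orient x y c + orient x y d -> 0 < orient x y p.
Proof.
move=> Q I ga gb gc gd gs; have [ka [kb [kc [kd [a0 b0 c0 d0 /(_ x y) h]]]]] := quad_weights Q I.
have K : 0 < ka + kb + kc + kd by lra.
rewrite -(pmulr_rgt0 _ K) h.
have [m1 m2] := conj (mulr_ge0 (ltW a0) ga) (mulr_ge0 (ltW b0) gb).
have [m3 m4] := conj (mulr_ge0 (ltW c0) gc) (mulr_ge0 (ltW d0) gd).
have [g|g] := ltP 0 (orient x y a); first by have := mulr_gt0 a0 g; lra.
have [g'|g'] := ltP 0 (orient x y b); first by have := mulr_gt0 b0 g'; lra.
have [g''|g''] := ltP 0 (orient x y c); first by have := mulr_gt0 c0 g''; lra.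
have g3 : 0 < orient x y d by lra.
by have := mulr_gt0 d0 g3; lra.
Qed.

Lemma ccw4_uniq a b c d : ccw4 a b c d -> uniq [:: a; b; c; d].
Proof.
case=> h1 h2 h3 h4.
have [ab bc ac] := orient_neq (lt0r_neq0 h1).
have [_ cd bd] := orient_neq (lt0r_neq0 h2).
have [_ da _] := orient_neq (lt0r_neq0 h3).
by rewrite /= !inE !negb_or ab ac bc bd cd eq_sym da.
Qed.

Definition config X Y : Prop :=
  [/\ uniq X, uniq Y, (forall p, p \in X -> p \notin Y) & general_position (X ++ Y)].

Lemma config_sym X Y : config X Y -> config Y X.
Proof.
case=> uX uY dis gp; split=> //.
  by move=> p pY; apply/negP => /dis; rewrite pY.
by move=> p q r; rewrite !mem_cat ![(_ \in Y) || _]orbC -!mem_cat; apply: gp.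
Qed.

Lemma config_gp X Y : config X Y -> general_position Y.
Proof.
by case=> _ _ _ gp p q r pY qY rY; apply: gp; rewrite mem_cat ?pY ?qY ?rY orbT.
Qed.

Lemma config_neq X Y x y : config X Y -> x \in X -> y \in Y -> x != y.
Proof. by case=> _ _ dis _ xX yY; apply: contraNneq (dis _ xX) => ->. Qed.

Lemma config_orient X Y u v x : config X Y -> u \in Y -> v \in Y -> x \in X -> u != v ->
  orient u v x != 0.
Proof.
move=> cf uY vY xX uv; have [_ _ _ gp] := cf.
by apply: (orient_neq0 gp) => //; rewrite ?mem_cat ?uY ?vY ?xX ?orbT //;
  apply: (config_neq cf).
Qed.

Lemma hole_sym X Y : balanced_convex_4hole X Y -> balanced_convex_4hole Y X.
Proof.
case=> a [b [c [d [hm hu hc hi [n1 n2]]]]]; exists a, b, c, d; split=> //.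
  by apply: sub_all hm => x; rewrite !mem_cat orbC.
by move=> p; rewrite mem_cat orbC -mem_cat; apply: hi.
Qed.

Lemma mk_hole X Y a b c d : config X Y -> ccw4 a b c d ->
  (forall p, p \in X ++ Y -> ~~ in_quad a b c d p) ->
  [/\ a \in X, b \in Y, c \in X & d \in Y] \/ [/\ a \in Y, b \in Y, c \in X & d \in X] ->
  balanced_convex_4hole X Y.
Proof.
move=> [_ _ dis _] Q hi hm.
have nX y : y \in Y -> (y \in X) = false.
  by move=> yY; apply/negP => /dis; rewrite yY.
have nY x : x \in X -> (x \in Y) = false by move=> /dis /negbTE.
exists a, b, c, d; split=> //.
- by case: hm => -[h1 h2 h3 h4]; rewrite /= !mem_cat h1 h2 h3 h4 ?orbT.
- exact: ccw4_uniq.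
- by move=> p /hi /in_quadP.
- by case: hm => -[h1 h2 h3 h4]; rewrite /= h1 h2 h3 h4 ?(nX _ h1) ?(nX _ h2) ?(nX _ h4)
    ?(nY _ h1) ?(nY _ h3) ?(nY _ h4).
Qed.

Lemma count_lt (P Q : pred (point F)) X x : (forall y, P y -> Q y) -> x \in X -> Q x -> ~~ P x ->
  (count P X < count Q X)%N.
Proof.
move=> sub xX Qx Px; elim: X xX => // y X IH; rewrite inE => /orP [/eqP <- /=|/IH /= lt].
  by rewrite Qx (negbTE Px) add0n add1n ltnS; apply: sub_count.
by rewrite -addnS leq_add //; case: (P y) (sub y) => // ->.
Qed.

(** The point [x] lies on the side of [a] of the diagonal [b d]. The new quadrilateral is contained
    in the old one, and [x] becomes a vertex, so the count drops. *)
Lemma shrink_quad X a b c d x : ccw4 a b c d -> x \in X -> in_quad a b c d x ->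
  0 < orient b d x ->
  ccw4 x b c d /\ (count (in_quad x b c d) X < count (in_quad a b c d) X)%N.
Proof.
move=> Q xX I g; have [h1 h2 h3 h4] := Q; have /and4P [g1 g2 g3 g4] := I.
have Q' : ccw4 x b c d by split; rewrite // 1?orientC // orientC.
split=> //.
have sub y : in_quad x b c d y -> in_quad a b c d y.
  move=> J; have /and4P [j1 j2 j3 j4] := J; rewrite /in_quad j2 j3.
  have -> : 0 < orient a b y.
    apply: (in_quad_orient_gt0 Q' J); rewrite ?orient_r ?(orientC a b d) ?(orientC b d a); lra.
  have -> // : 0 < orient d a y.
  have e1 : orient d a c = orient c d a by rewrite [RHS]orientC.
  apply: (in_quad_orient_gt0 Q' J); rewrite ?orient_l ?e1; lra.
apply: (count_lt sub xX I).
by rewrite /in_quad orient_l ltxx.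
Qed.

Lemma crossing_hole X Y a b c d : config X Y -> a \in X -> b \in Y -> c \in X -> d \in Y ->
  ccw4 a b c d -> balanced_convex_4hole X Y.
Proof.
move=> cf.
have cr a' b' c' d' : count (in_quad b' c' d' a') (X ++ Y) = count (in_quad a' b' c' d') (X ++ Y).
  by apply: eq_count => z; rewrite in_quad_rot.
have [n] := ubnP (count (in_quad a b c d) (X ++ Y)).
elim: n a b c d => // n IH a b c d; rewrite ltnS => ln aX bY cX dY Q.
have [/hasP [x xS I]|/hasPn hi] := boolP (has (in_quad a b c d) (X ++ Y)); last first.
  by apply: (mk_hole cf Q hi); left.
have [h1 h2 h3 h4] := Q; have /and4P [g1 g2 g3 g4] := I.
have bd : b != d by have [_ _ ] := orient_neq (lt0r_neq0 h2).
have ac : a != c by have [_ _ ] := orient_neq (lt0r_neq0 h1).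
(* A point of [X] replaces whichever of [a], [c] is on its side of [b d]; a point of [Y] replaces
   [b] or [d] according to [a c]. Rotations reduce all four cases to [shrink_quad]. *)
move: (xS); rewrite mem_cat => /orP [xX|xY].
  have := config_orient cf bY dY xX bd.
  rewrite neq_lt => /orP [s|s]; last first.
    have [Q' lt] := shrink_quad Q xS I s.
    by apply: (IH x b c d) => //; apply: leq_trans lt ln.
  have I' : in_quad c d a b x by rewrite -in_quad_rot -in_quad_rot.
  have [|Q' lt] := shrink_quad (ccw4_rot (ccw4_rot Q)) xS I'; first by rewrite orientN; lra.
  apply: (IH a b x d) => //; last exact: ccw4_rot (ccw4_rot Q').
  rewrite -(cr a b x d) -(cr b x d a); apply: leq_trans lt _.
  by rewrite (cr b c d a) (cr a b c d).
have := config_orient (config_sym cf) aX cX xY ac.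
rewrite neq_lt => /orP [s|s]; last first.
  have I' : in_quad d a b c x by rewrite -in_quad_rot.
  have [//|Q' lt] := shrink_quad (ccw4_rot (ccw4_rot (ccw4_rot Q))) xS I'.
  apply: (IH a b c x) => //; last exact: ccw4_rot Q'.
  by rewrite (cr x a b c); apply: leq_trans lt _; rewrite -(cr d a b c).
have I' : in_quad b c d a x by rewrite in_quad_rot.
have [|Q' lt] := shrink_quad (ccw4_rot Q) xS I'; first by rewrite orientN; lra.
apply: (IH a x c d) => //; last exact: ccw4_rot (ccw4_rot (ccw4_rot Q')).
by rewrite -(cr a x c d); apply: leq_trans lt _; rewrite (cr a b c d).
Qed.

(** Both differences in [e] are the same cross product of the diagonals, so the signs on one
    diagonal decide those on the other. *)
Lemma segments_cross_ccw4 a b c d : orient a c b < 0 -> 0 < orient a c d ->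
  orient b d a * orient b d c < 0 -> ccw4 a b c d.
Proof.
move=> h1 h2 h3.
have e : orient b d a - orient b d c = orient a c d - orient a c b by rewrite /orient; ring.
have g : orient b d c < 0 < orient b d a.
  apply/andP; split; rewrite ltNge; apply/negP => g.
    have g' : 0 <= orient b d a by lra.
    by have := mulr_ge0 g' g; lra.
  have g' : orient b d c <= 0 by lra.
  by have := mulr_le0 g g'; lra.
by move: h1 h2 g; rewrite /ccw4 /orient => h1 h2 /andP [g1 g2]; split; lra.
Qed.

Lemma shared_boundary_hole X Y p : config X Y ->
  on_hull_boundary X p -> on_hull_boundary Y p -> balanced_convex_4hole X Y.
Proof.
(* The triangle case of [caratheodory] would put [p] in the interior, so [p] is a point of the set
   or inside a segment. General position and disjointness leave one segment of each colour, meeting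
   at [p]. *)
have seg X' : uniq X' -> on_hull_boundary X' p ->
    p \in X' \/ exists a b, [/\ a \in X', b \in X', p != a, orient p a b = 0 & dot p a b < 0].
  move=> uX [hp ni]; case: (caratheodory hp) => [|[a [b [aX bX e d]]]|]; first by left.
    right; exists a, b; split=> //; apply: contraTneq d => ->.
    by rewrite /dot !subrr !mul0r addr0 ltxx.
  by case=> a [b [c [aX bX cX [h1 h2 h3]]]]; case: ni; apply: (hull_interior_triangle uX aX bX cX).
have neq a b : orient p a b = 0 -> dot p a b < 0 -> a != b.
  move=> e d; apply: contraTneq d => ->; rewrite -leNgt /dot.
  by rewrite addr_ge0 // -expr2 sqr_ge0.
move=> cf bX bY; have [uX uY dis gp] := cf.
have one X' Y' : config X' Y' -> p \in X' ->
    ~ exists a b, [/\ a \in Y', b \in Y', p != a, orient p a b = 0 & dot p a b < 0].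
  move=> cf' pX [a [b [aY bY' pa e d]]].
  have := config_orient cf' aY bY' pX (neq _ _ e d).
  by rewrite -orientC e eqxx.
have [pX|[a [c [aX cX pa e d]]]] := seg _ uX bX.
  have [pY|sY] := seg _ uY bY; first by have := dis _ pX; rewrite pY.
  by case: (one _ _ cf pX sY).
have [pY|[b [b' [bY1 bY2 pb e' d']]]] := seg _ uY bY.
  by case: (one _ _ (config_sym cf) pY); exists a, c.
have ac := neq _ _ e d; have bb := neq _ _ e' d'.
have opp u v x y : u != p -> orient p u v = 0 -> dot p u v < 0 -> orient p x y = 0 ->
    orient x y u != 0 -> orient x y u * orient x y v < 0.
  move=> up z dd z' nz.
  have nu := dot_gt0 up.
  have E : dot p u u * (orient x y u * orient x y v) = dot p u v * (orient x y u * orient x y u).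
    have e1 : orient x y v = orient p x y + ((y.1 - x.1) * (v.2 - p.2) - (y.2 - x.2) * (v.1 - p.1)).
      by rewrite /orient; ring.
    have e2 : orient x y u = orient p x y + ((y.1 - x.1) * (u.2 - p.2) - (y.2 - x.2) * (u.1 - p.1)).
      by rewrite /orient; ring.
    rewrite e1 e2 z' !add0r.

    have E2 : dot p u u * ((y.1 - x.1) * (v.2 - p.2) - (y.2 - x.2) * (v.1 - p.1)) =
       dot p u v * ((y.1 - x.1) * (u.2 - p.2) - (y.2 - x.2) * (u.1 - p.1)) +
       orient p u v * ((y.1 - x.1) * (u.1 - p.1) + (y.2 - x.2) * (u.2 - p.2)).
      by rewrite /dot /orient; ring.
    by rewrite z mul0r addr0 in E2; rewrite mulrCA E2 mulrCA.
  rewrite -(pmulr_rlt0 _ nu) E pmulr_llt0 //.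
  by rewrite -expr2 exprn_even_gt0.
have nb : orient a c b != 0 by apply: (config_orient (config_sym cf)).
have na : orient b b' a != 0 by apply: (config_orient cf).
have h1 : orient a c b * orient a c b' < 0 by apply: opp => //; rewrite eq_sym.
have h2 : orient b b' a * orient b b' c < 0 by apply: opp => //; rewrite eq_sym.
have [s|s|s] := ltgtP (orient a c b) 0; last by rewrite s eqxx in nb.
  apply: (crossing_hole cf aX bY1 cX bY2); apply: segments_cross_ccw4 => //.
  by rewrite -(nmulr_rlt0 _ s).
apply: (crossing_hole cf aX bY2 cX bY1); apply: segments_cross_ccw4 => //.
  by rewrite -(pmulr_rlt0 _ s).
by rewrite !(orientN b b') mulrNN.
Qed.

(** All of [Y] is on the other side of [u v], so only points of [X] could lie inside the
    quadrilateral. *)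
Lemma edge_hole X Y u v r s : config X Y -> r \in X -> s \in X -> edge Y u v ->
  orient u v r < 0 -> orient u v s < 0 -> 0 < orient r s u -> 0 < orient r s v ->
  (forall x, x \in X -> ccw4 v u r s -> ~~ in_quad v u r s x) -> balanced_convex_4hole X Y.
Proof.
move=> cf rX sX [uY vY uv hB] h1 h2 h3 h4 hi.
have Q : ccw4 v u r s by move: h1 h2 h3 h4; rewrite /ccw4 /orient => h1 h2 h3 h4; split; lra.
apply: (mk_hole cf Q); last by right.
move=> p; rewrite mem_cat => /orP [pX|pY]; first exact: hi.
apply/negP => /and4P [g _ _ _]; have := hB _ pY; rewrite orientN in g; lra.
Qed.

(** Any point of [Y] forces [a], [b], [c] to be counterclockwise, by [in_tri_gt0]. *)
Definition empty_tri X Y a b c : Prop :=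
  [/\ a \in X, b \in X, c \in X, forall x, x \in X -> ~ in_tri a b c x &
      forall y, y \in Y -> in_tri a b c y].

Lemma empty_tri_rot X Y a b c : empty_tri X Y a b c -> empty_tri X Y b c a.
Proof.
case=> aX bX cX eX tY; split=> //; last by move=> y /tY /in_tri_rot.
by move=> x xX /in_tri_rot /in_tri_rot; apply: eX.
Qed.

Lemma edge_tri_hole X Y a b c u v : config X Y -> empty_tri X Y a b c -> edge Y u v ->
  orient u v a < 0 -> orient u v b < 0 -> balanced_convex_4hole X Y.
Proof.
move=> cf [aX bX cX eX tY] E ha hb; have [uY vY uv hB] := E.
have [u1 u2 u3] := tY _ uY; have [v1 v2 v3] := tY _ vY.
have T := in_tri_gt0 (tY _ uY).
apply: (edge_hole cf aX bX E) => // x xX Q; apply/negP => I.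
have /and4P [_ _ g _] := I.
(* The quadrilateral is contained in the empty triangle. *)
apply: (eX _ xX); split=> //; apply: (in_quad_orient_gt0 Q I);
  rewrite ?orient_l ?orient_r ?(orientC c a b) -?(orientC a b c); lra.
Qed.

(** * Empty red triangles containing all blue points *)

(** With [x] to the right and [y] to the left, the ray from [b0] through [b1] leaves the triangle
    across the side [x y]. As [b1] is outside, the segments [x y] and [b0 b1] cross. *)
Lemma exit_side_hole X Y x y z b0 b1 : config X Y -> x \in X -> y \in X -> b0 \in Y -> b1 \in Y ->
  in_tri x y z b0 -> ~ in_tri x y z b1 -> orient b0 b1 x < 0 -> 0 < orient b0 b1 y ->
  balanced_convex_4hole X Y.
Proof.
move=> cf xX yX b0Y b1Y T nT hx hy; have h := in_tri_gt0 T; have [t1 t2 t3] := T.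
have g : orient x y b1 < 0.
  rewrite ltNge; apply/negP => g; apply: nT.
  have g2 : 0 < orient y z b1.
    rewrite ltNge; apply/negP => g2.
    have := mulr_gt0 h hy; have := mulr_ge0_le0 (ltW t1) g2; have := mulr_ge0 (ltW t2) g.
    by rewrite /orient; lra.
  have g3 : 0 < orient z x b1.
    rewrite ltNge; apply/negP => g3.
    have hx' : 0 < - orient b0 b1 x by lra.
    have := mulr_gt0 h hx'; have := mulr_ge0_le0 (ltW t1) g3; have := mulr_ge0 (ltW t3) g.
    by rewrite /orient; lra.
  split=> //; rewrite lt_def g andbT; have [xy _ _] := orient_neq (lt0r_neq0 h).
  exact: (config_orient (config_sym cf)).
apply: (crossing_hole cf xX b1Y yX b0Y).
by move: g hx hy t1; rewrite /ccw4 /orient => g hx hy t1; split; lra.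
Qed.

Lemma exit_tri_hole X Y a b c b0 b1 : config X Y -> a \in X -> b \in X -> c \in X ->
  b0 \in Y -> b1 \in Y -> in_tri a b c b0 -> ~ in_tri a b c b1 -> balanced_convex_4hole X Y.
Proof.
move=> cf aX bX cX b0Y b1Y T nT.
have T1 := in_tri_rot T; have T2 := in_tri_rot T1.
have nT1 : ~ in_tri b c a b1 by move=> /in_tri_rot /in_tri_rot.
have nT2 : ~ in_tri c a b b1 by move=> /in_tri_rot.
have b01 : b0 != b1 by apply: contra_not_neq nT => <-.
have na := config_orient cf b0Y b1Y aX b01.
have nb := config_orient cf b0Y b1Y bX b01.
have nc := config_orient cf b0Y b1Y cX b01.
(* The line through [b0] cannot have all three vertices on one side, so some side runs from its
   right to its left. *)
move: na nb nc; rewrite !neq_lt => /orP [] ha /orP [] hb /orP [] hc.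
- have : 0 < orient b1 b0 b0.
    by apply: (in_tri_orient_gt0 T); rewrite !(orientN b0 b1); lra.
  by rewrite orient_r ltxx.
- exact: (exit_side_hole cf bX cX b0Y b1Y T1).
- exact: (exit_side_hole cf aX bX b0Y b1Y T).
- exact: (exit_side_hole cf aX bX b0Y b1Y T).
- exact: (exit_side_hole cf cX aX b0Y b1Y T2).
- exact: (exit_side_hole cf bX cX b0Y b1Y T1).
- exact: (exit_side_hole cf cX aX b0Y b1Y T2).
- have : 0 < orient b0 b1 b0 by apply: (in_tri_orient_gt0 T); lra.
  by rewrite orient_l ltxx.
Qed.

Lemma in_hull_in_tri X Y p : config X Y -> p \in Y -> in_hull X p ->
  exists a b c, [/\ a \in X, b \in X, c \in X & in_tri a b c p].
Proof.
move=> cf pY /caratheodory [pX|[a [b [aX bX e d]]]|//].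
  by have := config_neq cf pX pY; rewrite eqxx.
have ab : a != b.
  apply: contraTneq d => ->; rewrite -leNgt /dot.
  by rewrite addr_ge0 // -expr2 sqr_ge0.
by have := config_orient (config_sym cf) aX bX pY ab; rewrite -orientC e eqxx.
Qed.

Lemma in_tri_sub a b c x y : in_tri a b c x -> in_tri a b x y -> in_tri a b c y.
Proof.
move=> T S; have h := in_tri_gt0 T; have [t1 t2 t3] := T; have [s1 s2 s3] := S.
split=> //; apply: (in_tri_orient_gt0 S); rewrite ?orient_l ?orient_r;
  move: h t2 t3; rewrite /orient; lra.
Qed.

Definition in_trib a b c p : bool := [&& 0 < orient a b p, 0 < orient b c p & 0 < orient c a p].

Lemma in_tribP a b c p : reflect (in_tri a b c p) (in_trib a b c p).
Proof. exact: and3P. Qed.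

Lemma shrink_tri X a b c x : x \in X -> in_tri a b c x ->
  (count (in_trib a b x) X < count (in_trib a b c) X)%N.
Proof.
move=> xX T; apply: (count_lt _ xX); last 2 first.
- exact/in_tribP.
- by rewrite /in_trib orient_r ltxx andbF.
by move=> y /in_tribP S; apply/in_tribP; apply: in_tri_sub T S.
Qed.

Lemma in_tri_split X Y a b c x p : config X Y -> a \in X -> b \in X -> c \in X ->
  x \in X -> p \in Y -> in_tri a b c x -> in_tri a b c p ->
  [\/ in_tri a b x p, in_tri b c x p | in_tri c a x p].
Proof.
move=> cf aX bX cX xX pY T S; have [s1 s2 s3] := S; have [t1 t2 t3] := T.
have [_ _ ax] := orient_neq (lt0r_neq0 t1).
have [_ bx _] := orient_neq (lt0r_neq0 t1).
have [_ cx _] := orient_neq (lt0r_neq0 t2).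
have na := config_orient (config_sym cf) aX xX pY ax.
have nb := config_orient (config_sym cf) bX xX pY bx.
have nc := config_orient (config_sym cf) cX xX pY cx.
have e y : orient x y p = - orient y x p by rewrite orientN.
have e' y : orient p x y = - orient y x p by rewrite /orient; ring.
have e'' y : orient x p y = orient y x p by rewrite /orient; ring.
move: na nb nc; rewrite !neq_lt => /orP [] ha /orP [] hb /orP [] hc.
- have : 0 < orient p x x by apply: (in_tri_orient_gt0 T); rewrite !e'; lra.
  by rewrite orient_r ltxx.
- by constructor 2; split=> //; rewrite ?e; lra.
- by constructor 1; split=> //; rewrite ?e; lra.
- by constructor 1; split=> //; rewrite ?e; lra.
- by constructor 3; split=> //; rewrite ?e; lra.
- by constructor 2; split=> //; rewrite ?e; lra.
- by constructor 3; split=> //; rewrite ?e; lra.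
- have : 0 < orient x p x by apply: (in_tri_orient_gt0 T); rewrite !e''; lra.
  by rewrite orient_l ltxx.
Qed.

(** A triangle around one fixed [b0] is subdivided at an interior point of [X] until none is left. A
    point of [Y] outside the final triangle then gives a crossing. *)
Lemma hole_or_empty_tri X Y : config X Y -> Y != [::] -> (forall y, y \in Y -> in_hull X y) ->
  balanced_convex_4hole X Y \/ exists a b c, empty_tri X Y a b c.
Proof.
move=> cf Yn hY; have [b0 b0Y] : exists b0, b0 \in Y.
  by case: Y Yn {cf hY} => // y Y _; exists y; rewrite mem_head.
have [a [b [c [aX bX cX T]]]] := in_hull_in_tri cf b0Y (hY _ b0Y).
have [n] := ubnP (count (in_trib a b c) X).
elim: n a b c aX bX cX T => // n IH a b c aX bX cX T; rewrite ltnS => ln.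
have [/hasP [x xX /in_tribP I]|/hasPn hi] := boolP (has (in_trib a b c) X); last first.
  have [H|H] := classic (balanced_convex_4hole X Y); [by left|right].
  exists a, b, c; split=> //; first by move=> x /hi /in_tribP.
  move=> y yY; apply: NNPP => nT; apply: H.
  exact: (exit_tri_hole cf aX bX cX b0Y yY T nT).
have cr a' b' c' : count (in_trib b' c' a') X = count (in_trib a' b' c') X.
  by apply: eq_count => z; rewrite /in_trib; do 3![case: (0 < _)].
case: (in_tri_split cf aX bX cX xX b0Y I T) => S.
- by apply: (IH a b x) => //; apply: leq_trans (shrink_tri xX I) ln.
- apply: (IH b c x) => //; apply: leq_trans (shrink_tri xX (in_tri_rot I)) _.
  by rewrite cr.
- apply: (IH c a x) => //; apply: leq_trans (shrink_tri xX (in_tri_rot (in_tri_rot I))) _.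
  by rewrite -(cr c a b).
Qed.

(** If the restored [y] were inside the hole, it would be a positive average of the vertices while
    having the minimal value of [orient z1 z2]. All vertices would share that value, but the points
    of [Y] exceed it. *)
Lemma hole_add_extreme X Y y z1 z2 : config X Y -> y \in X ->
  (forall x, x \in X -> orient z1 z2 y <= orient z1 z2 x) ->
  (forall x, x \in Y -> orient z1 z2 y < orient z1 z2 x) ->
  balanced_convex_4hole (rem y X) Y -> balanced_convex_4hole X Y.
Proof.
move=> cf yX hX hY [a [b [c [d [hm hu Q hi [n1 n2]]]]]].
have [uX _ dis _] := cf.
have mr x : (x \in rem y X) = (x != y) && (x \in X) by rewrite mem_rem_uniq.
exists a, b, c, d; split=> //.
- by apply: sub_all hm => x; rewrite !mem_cat mr => /orP [/andP [_ ->]|->]; rewrite ?orbT.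
- move=> p; rewrite mem_cat => /orP [pX|pY]; last by apply: hi; rewrite mem_cat pY orbT.
  have [->|py] := eqVneq p y; last by apply: hi; rewrite mem_cat mr py pX.
  move=> /in_quadP I; have [ka [kb [kc [kd [a0 b0 c0 d0 /(_ z1 z2) h]]]]] := quad_weights Q I.
  have le x : x \in [:: a; b; c; d] -> 0 <= orient z1 z2 x - orient z1 z2 y.
    move=> xm; have := allP hm _ xm; rewrite mem_cat mr => /orP [/andP [_ /hX]|/hY]; lra.
  have ga := mulr_ge0 (ltW a0) (le a _); have gb := mulr_ge0 (ltW b0) (le b _).
  have gc := mulr_ge0 (ltW c0) (le c _); have gd := mulr_ge0 (ltW d0) (le d _).
  move: ga gb gc gd; rewrite !inE !eqxx ?orbT => /(_ isT) ga /(_ isT) gb /(_ isT) gc /(_ isT) gd.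
  have z x (k : F) : 0 < k -> k * (orient z1 z2 x - orient z1 z2 y) = 0 -> (x \in Y) = false.
    move=> k0 /eqP; rewrite mulf_eq0 gt_eqF //= => /eqP e; apply/negP => /hY; lra.
  have za : (a \in Y) = false by apply: (z _ _ a0); lra.
  have zb : (b \in Y) = false by apply: (z _ _ b0); lra.
  have zc : (c \in Y) = false by apply: (z _ _ c0); lra.
  have zd : (d \in Y) = false by apply: (z _ _ d0); lra.
  by move: n2; rewrite /= za zb zc zd.
- split=> //; rewrite -n1; apply: eq_in_count => x xm.
  have := allP hm _ xm; rewrite mem_cat mr.
  have [->|] //= := eqVneq x y.
  by move=> yY; have := dis _ yX; rewrite yY.
Qed.

(** Transitivity of the angular order around [p] within an open half-plane bounded by [p c], by the
    Grassmann-Pluecker relation. *)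
Lemma ccw_trans p q b c d : 0 < orient p q c -> 0 < orient p b c -> 0 < orient p d c ->
  0 < orient p b q -> 0 < orient p q d -> 0 < orient p b d.
Proof.
move=> h1 h2 h3 h4 h5; rewrite -(pmulr_rgt0 _ h1).
by have := mulr_gt0 h2 h5; have := mulr_gt0 h3 h4; rewrite /orient; lra.
Qed.

Lemma tri_visible_edge X Y a b c : config X Y -> empty_tri X Y a b c -> (1 < size Y)%N ->
  exists u v, edge Y u v /\ orient u v b < 0.
Proof.
move=> cf [aX bX cX eX tY] sY; have [_ uY _ _] := cf.
apply: (hull_edge_visible uY (config_gp cf) sY).
  by move=> x y xY yY xy; apply: (config_orient cf).
move=> hb; have : 0 < orient b c b.
  by apply: in_hull_orient_gt0 hb => y /tY [].
by rewrite orient_l ltxx.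
Qed.

(** * Four red points *)

Lemma four_hull_edge_hole X Y a b c q u v r s : config X Y ->
  (forall x, x \in X -> x \in [:: a; b; c; q]) -> r \in X -> s \in X -> edge Y u v ->
  (forall x, x \in [:: a; b; c; q] -> x != r -> x != s -> 0 < orient u v x) ->
  orient u v r < 0 -> orient u v s < 0 -> 0 < orient r s u -> 0 < orient r s v ->
  balanced_convex_4hole X Y.
Proof.
move=> cf hX rX sX E hin hr hs h1 h2; apply: (edge_hole cf rX sX E) => // x xX _.
rewrite /in_quad; apply/negP => /and4P [g1 _ g3 _].
have [e|nr] := eqVneq x r; first by move: g3; rewrite e orient_l ltxx.
have [e|ns] := eqVneq x s; first by move: g3; rewrite e orient_r ltxx.
by have := hin _ (hX _ xX) nr ns; rewrite orientN in g1; lra.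
Qed.

(** Here [a q b c] is in convex position. If the diagonal [c q] splits [Y], there is a crossing.
    Otherwise [Y] lies in the triangle [q b c] or [a q c], and a hull edge visible from the
    remaining vertex is visible from [q] as well, unless it already sees two vertices of [a b c]. *)
Lemma convex_four_hole X Y a b c q : config X Y -> empty_tri X Y a b c -> q \in X ->
  (forall x, x \in X -> x \in [:: a; b; c; q]) -> (1 < size Y)%N ->
  orient a b q < 0 -> 0 < orient b c q -> 0 < orient c a q -> balanced_convex_4hole X Y.
Proof.
move=> cf E qX hX sY q1 q2 q3; have [aX bX cX eX tY] := E.
have [u0 [v0 [[u0Y _ _ _] _]]] := tri_visible_edge cf E sY.
have T0 := in_tri_gt0 (tY _ u0Y).
have haq y : y \in Y -> 0 < orient a q y.
  move=> yY; apply: (in_tri_orient_gt0 (tY _ yY)); move: q1 q3; rewrite /orient; lra.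
have hqb y : y \in Y -> 0 < orient q b y.
  move=> yY; apply: (in_tri_orient_gt0 (tY _ yY)); move: q1 q2; rewrite /orient; lra.
have cq : c != q by have [_ ? _] := orient_neq (lt0r_neq0 q2).
have nz y : y \in Y -> orient c q y != 0 by move=> yY; apply: (config_orient (config_sym cf)).
have [/hasP [y yY hy]|/hasPn hpos] := boolP (has (fun y => orient c q y < 0) Y); last first.
  have {}hpos y : y \in Y -> 0 < orient c q y.
    by move=> yY; rewrite lt_def nz // leNgt hpos.
  have [u [v [Eu hu]]] := tri_visible_edge cf (empty_tri_rot (empty_tri_rot E)) sY.
  have [uY vY uv hB] := Eu.
  have [hb|hb] := ltP (orient u v b) 0; first exact: (edge_tri_hole cf E Eu).
  have [hc|hc] := ltP (orient u v c) 0.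
    exact: (edge_tri_hole cf (empty_tri_rot (empty_tri_rot E)) Eu).
  have hb' : 0 < orient u v b by rewrite lt_def hb (config_orient cf).
  have hc' : 0 < orient u v c by rewrite lt_def hc (config_orient cf).
  have hq : orient u v q < 0.
    rewrite ltNge; apply/negP => hq.
    have : 0 < orient u v u.
      apply: (@in_tri_orient_gt0 q b c u) => //; last by lra.
      by have [? ? ?] := tY _ uY; split; rewrite ?hqb ?hpos.
    by rewrite orient_l ltxx.
  apply: (four_hull_edge_hole cf hX aX qX Eu) => //; rewrite ?haq //.
  by move=> x; rewrite !inE => /or4P [] /eqP -> //; rewrite ?eqxx.
have [/hasP [y' yY' hy']|/hasPn hneg] := boolP (has (fun y => 0 < orient c q y) Y).
  apply: (crossing_hole cf cX yY qX yY').
  have [y1 y2 y3] := tY _ yY; have [z1 z2 z3] := tY _ yY'.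
  have g1 : 0 < orient c y y'.
    apply: (@ccw_trans c q y b y'); move: q2 y2 z2 hy hy'; rewrite /orient; lra.
  have g2 : 0 < orient q y' y.
    have := haq _ yY; have := haq _ yY'.
    move=> w1 w2; apply: (@ccw_trans q c y' a y);
      move: q3 w1 w2 hy hy'; rewrite /orient; lra.
  by move: g1 g2 hy hy'; rewrite /ccw4 /orient => g1 g2 hy1 hy2; split; lra.
have {}hneg z : z \in Y -> 0 < orient q c z.
  by move=> zY; rewrite orientN oppr_gt0 lt_def eq_sym nz // leNgt hneg.
have [u [v [Eu hu]]] := tri_visible_edge cf E sY.
have [uY vY uv hB] := Eu.
have [ha|ha] := ltP (orient u v a) 0; first exact: (edge_tri_hole cf E Eu).
have [hc|hc] := ltP (orient u v c) 0; first exact: (edge_tri_hole cf (empty_tri_rot E) Eu).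
have ha' : 0 < orient u v a by rewrite lt_def ha (config_orient cf).
have hc' : 0 < orient u v c by rewrite lt_def hc (config_orient cf).
have hq : orient u v q < 0.
  rewrite ltNge; apply/negP => hq.
  have : 0 < orient u v u.
    apply: (@in_tri_orient_gt0 a q c u) => //; last by lra.
    by have [? ? ?] := tY _ uY; split; rewrite ?haq ?hneg.
  by rewrite orient_l ltxx.
apply: (four_hull_edge_hole cf hX qX bX Eu) => //; rewrite ?hqb //.
by move=> x; rewrite !inE => /or4P [] /eqP -> //; rewrite ?eqxx.
Qed.

(* Here [q] is behind the vertex [b], so that [b] lies inside the triangle [q c a]. *)
Lemma reflex_four_edge X Y a b c q u v : config X Y -> empty_tri X Y a b c -> q \in X ->
  (forall x, x \in X -> x \in [:: a; b; c; q]) ->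
  orient a b q < 0 -> orient b c q < 0 -> edge Y u v -> orient u v b < 0 ->
  balanced_convex_4hole X Y \/
  [/\ 0 < orient u v a, 0 < orient u v c, orient u v q < orient u v b &
      (orient b q u < 0 < orient b q v)].
Proof.
move=> cf E qX hX q1 q2 Eu hb; have [aX bX cX eX tY] := E; have [uY vY uv hB] := Eu.
have T0 := in_tri_gt0 (tY _ uY).
have [ha|ha] := ltP (orient u v a) 0; first by left; apply: (edge_tri_hole cf E Eu).
have [hc|hc] := ltP (orient u v c) 0.
  by left; apply: (edge_tri_hole cf (empty_tri_rot E) Eu).
have ha' : 0 < orient u v a by rewrite lt_def ha (config_orient cf).
have hc' : 0 < orient u v c by rewrite lt_def hc (config_orient cf).
(* Being behind [b], the point [q] is farther beyond [u v] than [b], since [a] and [c] are on the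
   inner side. *)
have hq : orient u v q < orient u v b.
  rewrite -subr_lt0 -(pmulr_rlt0 _ T0).
  have k1 : 0 < orient u v a - orient u v b by lra.
  have k2 : 0 < orient u v c - orient u v b by lra.
  have q1' : 0 < - orient a b q by lra.
  have q2' : 0 < - orient b c q by lra.
  have := mulr_gt0 q2' k1; have := mulr_gt0 q1' k2.
  by rewrite /orient; lra.
have bq : b != q by have [_ ? _] := orient_neq (ltr0_neq0 q1).
have hq' : orient u v q < 0 by lra.
have nu : orient b q u != 0 by apply: (config_orient (config_sym cf)).
have nv : orient b q v != 0 by apply: (config_orient (config_sym cf)).
have e : orient b q v - orient b q u = orient u v b - orient u v q by rewrite /orient; ring.
move: nu nv; rewrite !neq_lt => /orP [] hu /orP [] hv.
- left; apply: (four_hull_edge_hole cf hX qX bX Eu) => //; rewrite ?(orientN b q) ?oppr_gt0 //.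
  by move=> x; rewrite !inE => /or4P [] /eqP -> //; rewrite ?eqxx.
- by right; rewrite hu hv.
- lra.
- left; apply: (four_hull_edge_hole cf hX bX qX Eu) => //.
  by move=> x; rewrite !inE => /or4P [] /eqP -> //; rewrite ?eqxx.
Qed.

(** The edge [u v] straddles the line [b q], and [w1] is a further point on the side of [u]. The
    preceding edge [w0 u] yields a hole if it is visible from [b] or [q]; otherwise [b], [q], [u]
    and a suitable [w] on that side form one. *)
Lemma reflex_four_side_hole X Y a b c q u v w1 : config X Y -> empty_tri X Y a b c -> q \in X ->
  (forall x, x \in X -> x \in [:: a; b; c; q]) ->
  orient a b q < 0 -> orient b c q < 0 -> edge Y u v -> orient u v b < 0 ->
  orient u v q < orient u v b -> orient b q u < 0 < orient b q v ->
  w1 \in Y -> w1 != u -> orient b q w1 < 0 -> balanced_convex_4hole X Y.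
Proof.
move=> cf E qX hX q1 q2 Eu hb hq /andP [hu hv] w1Y w1u hw1.
have [aX bX cX eX tY] := E; have [uY vY uv hB] := Eu.
have gpY := config_gp cf.
have T0 := in_tri_gt0 (tY _ uY).
have q3 : 0 < orient c a q by have := orient_sum a b c q; lra.
have haq y : y \in Y -> 0 < orient a q y.
  move=> yY; apply: (in_tri_orient_gt0 (tY _ yY)); move: q1 q3; rewrite /orient; lra.
have hqc y : y \in Y -> 0 < orient q c y.
  move=> yY; apply: (in_tri_orient_gt0 (tY _ yY)); move: q2 q3; rewrite /orient; lra.
have [w0 Ew] := edge_prev gpY Eu; have [w0Y _ w0u hW] := Ew.
have w1v : w1 != v by apply: contraTneq hw1 => ->; rewrite -leNgt ltW.
have hw1v : 0 < orient u v w1 by rewrite lt_def hB // (orient_neq0 gpY).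
have w0v : w0 != v.
  apply/eqP => e; have := hW _ w1Y; rewrite e orientN; lra.
have K : 0 < orient w0 u v.
  by rewrite lt_def hW // (orient_neq0 gpY) // eq_sym.
have := config_orient cf w0Y uY bX w0u; rewrite neq_lt => /orP [h|hwb].
  have [//|[_ _ _ /andP [_ g]]] := reflex_four_edge cf E qX hX q1 q2 Ew h.
  by lra.
have na : orient w0 u a != 0 by apply: (config_orient cf).
have nc : orient w0 u c != 0 by apply: (config_orient cf).
have := config_orient cf w0Y uY qX w0u; rewrite neq_lt => /orP [hwq|hwq].
  move: na nc; rewrite !neq_lt => /orP [] ha /orP [] hc.
  - exact: (edge_tri_hole cf (empty_tri_rot (empty_tri_rot E)) Ew).
  - apply: (four_hull_edge_hole cf hX aX qX Ew) => //; rewrite ?haq //.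
    by move=> x; rewrite !inE => /or4P [] /eqP -> //; rewrite ?eqxx.
  - apply: (four_hull_edge_hole cf hX qX cX Ew) => //; rewrite ?hqc //.
    by move=> x; rewrite !inE => /or4P [] /eqP -> //; rewrite ?eqxx.
  - have : 0 < orient w0 u u by apply: (in_tri_orient_gt0 (tY _ uY)); lra.
    by rewrite orient_r ltxx.
(* Now [b] and [q] are on the inner side of [w0 u]. With [w] the tangent point from [b], all of [Z]
   is on the outer side of the quadrilateral's side from [b] to [w]. *)
pose Z := [seq y <- Y | (y != u) && (orient b q y < 0)].
have ZP y : y \in Z -> [/\ y \in Y, y != u & orient b q y < 0].
  by rewrite mem_filter => /andP [/andP [? ?] ?].
have Zn : Z != [::].
  by have : w1 \in Z; [rewrite mem_filter w1u hw1|case: Z {ZP}].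
have bZ : b \notin Z by apply/negP => /ZP [bY _ _]; have := config_neq cf bX bY; rewrite eqxx.
have bq : b != q by have [_ ? _] := orient_neq (ltr0_neq0 q1).
have hd x y : x \in Z -> y \in Z -> orient b x y = 0 -> 0 <= dot b x y.
  move=> /ZP [xY _ _] /ZP [yY _ _] e.
  have [->|xy] := eqVneq x y; first by rewrite /dot addr_ge0 // -expr2 sqr_ge0.
  by have := config_orient cf xY yY bX xy; rewrite -orientC e eqxx.
have ht x y z : x \in Z -> y \in Z -> z \in Z ->
    0 < orient b x y -> 0 < orient b y z -> 0 < orient b z x -> False.
  move=> /ZP [_ _ hx] /ZP [_ _ hy] /ZP [_ _ hz] t1 t2 t3.
  have T : in_tri x y z b by split; rewrite -orientC.
  have : 0 < orient q b b by apply: (in_tri_orient_gt0 T); rewrite !(orientN b q); lra.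
  by rewrite orient_r ltxx.
have [w wZ hw] := tangent_point (or_intror (erefl (-1 : F))) Zn bZ hd ht.
have [wY wu hwbq] := ZP _ wZ.
have wv : w != v by apply: contraTneq hwbq => ->; rewrite -leNgt ltW.
have hvw : 0 < orient u v w by rewrite lt_def hB // (orient_neq0 gpY).
(* The ray from [u] to [w] lies in the angle at [u] between the edges to [w0] and [v]. *)
have uw f : orient u v f < 0 -> 0 < orient w0 u f -> orient u w f < 0.
  move=> f1 f2; rewrite -(pmulr_rlt0 _ K).
  have f1' : 0 < - orient u v f by lra.
  have := mulr_ge0 (hW _ wY) (ltW f1'); have := mulr_gt0 hvw f2.
  by rewrite /orient; lra.
have wb : orient u w b < 0 by apply: uw.
have wq : orient u w q < 0 by apply: uw; lra.
have Q : ccw4 w u q b.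
  by move: hu hwbq wb wq; rewrite /ccw4 /orient => g1 g2 g3 g4; split; lra.
apply: (mk_hole cf Q); last by right.
move=> p; rewrite mem_cat => /orP [pX|pY]; apply/negP=> I; have /and4P [g1 g2 g3 g4] := I.
  have := hX _ pX; rewrite !inE => /or4P [] /eqP e; rewrite e in I g1 g2 g3 g4.
  (* The lines [a q] and [q c] support the quadrilateral, which keeps [a] and [c] out of it. *)
  - have : 0 < orient a q a; last by rewrite orient_l ltxx.
    have := haq _ wY; have := haq _ uY => h1 h2.
    by apply: (in_quad_orient_gt0 Q I); rewrite ?orient_r //; move: q1 h1 h2; rewrite /orient; lra.
  - by move: g3; rewrite orient_r ltxx.
  - have : 0 < orient q c c; last by rewrite orient_r ltxx.
    have := hqc _ wY; have := hqc _ uY => h1 h2.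
    by apply: (in_quad_orient_gt0 Q I); rewrite ?orient_l //; move: q2 h1 h2; rewrite /orient; lra.
  - by move: g3; rewrite orient_l ltxx.
have pZ : p \in Z.
  rewrite mem_filter pY andbT; apply/andP; split.
    by apply: contraTneq g2 => ->; rewrite orient_l ltxx.
  by rewrite orientN in g3; lra.
by have := hw _ pZ; lra.
Qed.

(** Reflection exchanges the two ends of a visible edge, so that [reflex_four_side_hole] also covers
    the side of [v]. *)
Definition mirror p : point F := (- p.1, p.2).

Lemma orient_mirror a b c : orient (mirror a) (mirror b) (mirror c) = - orient a b c.
Proof. by rewrite /orient /mirror /=; ring. Qed.

Lemma mirrorK : involutive mirror.
Proof. by case=> x y; rewrite /mirror /= opprK. Qed.

Lemma mem_mirror X p : (mirror p \in map mirror X) = (p \in X).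
Proof. by rewrite mem_map //; apply: inv_inj mirrorK. Qed.

Lemma config_mirror X Y : config X Y -> config (map mirror X) (map mirror Y).
Proof.
have mi := inv_inj mirrorK.
case=> uX uY dis gp; split; rewrite ?map_inj_uniq //.
  by move=> p; rewrite -[p]mirrorK !mem_mirror; apply: dis.
move=> p q r; rewrite -map_cat -[p]mirrorK -[q]mirrorK -[r]mirrorK.
move: (mirror p) (mirror q) (mirror r) => {}p {}q {}r.
by rewrite !mem_mirror !(inj_eq mi) orient_mirror oppr_eq0; apply: gp.
Qed.

Lemma hole_mirror X Y : balanced_convex_4hole (map mirror X) (map mirror Y) ->
  balanced_convex_4hole X Y.
Proof.
have mi := inv_inj mirrorK.
case=> a [b [c [d []]]].
rewrite -[a]mirrorK -[b]mirrorK -[c]mirrorK -[d]mirrorK.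
move: (mirror a) (mirror b) (mirror c) (mirror d) => {}a {}b {}c {}d.
rewrite -map_cat /= !mem_mirror !orient_mirror andbT => /and4P [ma mb mc md] hu [h1 h2 h3 h4] hi [n1 n2].
have Q : ccw4 d c b a by move: h1 h2 h3 h4; rewrite /ccw4 /orient => h1 h2 h3 h4; split; lra.
exists d, c, b, a; split=> //.
- by rewrite /= ma mb mc md.
- exact: ccw4_uniq.
- move=> p pS [g1 g2 g3 g4]; apply: (hi (mirror p)); first by rewrite mem_mirror.
  by split; rewrite orient_mirror -orientN.
- by split; [move: n1|move: n2]; rewrite /=; do 4![case: (_ \in _)].
Qed.

Lemma reflex_four_hole X Y a b c q : config X Y -> empty_tri X Y a b c -> q \in X ->
  (forall x, x \in X -> x \in [:: a; b; c; q]) -> (1 < size Y)%N ->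
  orient a b q < 0 -> orient b c q < 0 -> balanced_convex_4hole X Y.
Proof.
move=> cf E qX hX sY q1 q2; have [aX bX cX eX tY] := E.
have [u [v [Eu hb]]] := tri_visible_edge cf E sY; have [uY vY uv hB] := Eu.
have [//|[ha hc hq huv]] := reflex_four_edge cf E qX hX q1 q2 Eu hb.
have [hu hv] := andP huv.
have [/hasP [w wY /andP [wu wv]]|/hasPn h2] := boolP (has (fun w => (w != u) && (w != v)) Y); last first.
  (* When [u] and [v] are all of [Y], the reversed edge is visible from [a] and [c]. *)
  have E' : edge Y v u.
    split=> //; first by rewrite eq_sym.
    move=> w /h2; rewrite negb_and !negbK => /orP [] /eqP ->; by rewrite ?orient_l ?orient_r.
  by apply: (edge_tri_hole cf (empty_tri_rot (empty_tri_rot E)) E'); rewrite orientN; lra.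
have bq : b != q by have [_ ? _] := orient_neq (ltr0_neq0 q1).
have := config_orient (config_sym cf) bX qX wY bq; rewrite neq_lt => /orP [hw|hw].
  exact: (reflex_four_side_hole cf E qX hX q1 q2 Eu hb hq huv wY wu hw).
apply: hole_mirror; pose m := mirror.
apply: (@reflex_four_side_hole _ _ (m c) (m b) (m a) (m q) (m v) (m u) (m w) (config_mirror cf));
  rewrite ?mem_mirror ?orient_mirror ?(inj_eq (inv_inj mirrorK)) //.
- split; rewrite ?mem_mirror // => x; rewrite -[x]mirrorK mem_mirror => xS.
    move=> T; apply: (eX _ xS); case: T; rewrite !orient_mirror -!orientN => ? ? ?.
    by split.
  by have [t1 t2 t3] := tY _ xS; split; rewrite orient_mirror -orientN.
- move=> x; rewrite -[x]mirrorK mem_mirror => /hX; rewrite !inE !(inj_eq (inv_inj mirrorK)).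
  by rewrite orbA orbC -!orbA orbCA [_ || (_ == q)]orbC; case: (_ == a); case: (_ == b); case: (_ == c).
- by rewrite -orientN; move: q2; rewrite /orient; lra.
- by rewrite -orientN; move: q1; rewrite /orient; lra.
- split; rewrite ?mem_mirror ?(inj_eq (inv_inj mirrorK)) // 1?eq_sym // => x.
  by rewrite -[x]mirrorK mem_mirror orient_mirror -orientN; apply: hB.
- by rewrite -orientN.
- by rewrite -!orientN.
- by apply/andP; split; lra.
- lra.
Qed.

(** With more than four points in [X], the one farthest beyond some side of the triangle is removed;
    it is extreme, so [hole_add_extreme] restores it. With four, [q] is beyond one side (convex
    case) or two (reflex case): three are excluded by the positive sum, none by emptiness. *)
Lemma empty_tri_hole X Y a b c : config X Y -> empty_tri X Y a b c ->
  (3 < size X)%N -> (1 < size Y)%N -> balanced_convex_4hole X Y.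
Proof.
have [n] := ubnP (size X); elim: n X a b c => // n IH X a b c; rewrite ltnS => ln cf E sX sY.
have [aX bX cX eX tY] := E; have [uX uY dis gp] := cf.
have [y0 y0Y] := size_gt0_mem (ltnW sY).
have T0 := in_tri_gt0 (tY _ y0Y); have [ab bc ac] := orient_neq (lt0r_neq0 T0).
have [q qX qn] : exists2 q, q \in X & q \notin [:: a; b; c].
  apply: NNPP => H; suff : (size X <= 3)%N by rewrite leqNgt sX.
  apply: (@uniq_leq_size _ X [:: a; b; c] uX) => x xX.
  by apply/negPn/negP => xn; apply: H; exists x.
have gpX := config_gp (config_sym cf).
have : orient a b q != 0 /\ orient b c q != 0 /\ orient c a q != 0.
  move: qn; rewrite !inE !negb_or => /and3P [qa qb qc].
  by rewrite !(orient_neq0 gpX) // eq_sym.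
case=> n1 [n2 n3].
have [s5|s4] := ltnP 4 (size X).
  have far a' b' c' : empty_tri X Y a' b' c' -> orient a' b' q < 0 -> balanced_convex_4hole X Y.
    move=> E' hq; have [aX' bX' cX' eX' tY'] := E'.
    have T' := in_tri_gt0 (tY' _ y0Y).
    have [y yX hy] := argmin_seq (orient a' b') (mem_neq_nil qX).
    have yn : orient a' b' y < 0 by apply: le_lt_trans (hy _ qX) hq.
    have mr x : (x \in rem y X) = (x != y) && (x \in X) by rewrite mem_rem_uniq.
    have ny x : 0 <= orient a' b' x -> x != y by move=> h; apply: contraTneq h => ->; rewrite -ltNge.
    apply: (hole_add_extreme cf yX hy).
      by move=> x /tY' [h _ _]; lra.
    have sr : size (rem y X) = (size X).-1 by rewrite size_rem.
    apply: (IH _ a' b' c').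
    - by rewrite sr; case: (size X) s5 ln.
    - split=> //; first exact: rem_uniq.
        by move=> p; rewrite mr => /andP [_ /dis].
      move=> p1 p2 p3 m1 m2 m3; apply: gp.
      + by move: m1; rewrite !mem_cat mr => /orP [/andP [_ ->]|->]; rewrite ?orbT.
      + by move: m2; rewrite !mem_cat mr => /orP [/andP [_ ->]|->]; rewrite ?orbT.
      + by move: m3; rewrite !mem_cat mr => /orP [/andP [_ ->]|->]; rewrite ?orbT.
    - split=> //; last by move=> x; rewrite mr => /andP [_ xX]; apply: eX'.
      + by rewrite mr aX' ny // orient_l.
      + by rewrite mr bX' ny // orient_r.
      + by rewrite mr cX' ny // ltW.
    - by rewrite sr; case: (size X) s5.
    - by [].
  have [h|h] := ltP (orient a b q) 0; first exact: (far a b c).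
  have [h'|h'] := ltP (orient b c q) 0; first exact: (far _ _ _ (empty_tri_rot E)).
  have [h''|h''] := ltP (orient c a q) 0; first exact: (far _ _ _ (empty_tri_rot (empty_tri_rot E))).
  by case: (eX _ qX); split; rewrite lt_def ?n1 ?n2 ?n3.
have hX x : x \in X -> x \in [:: a; b; c; q].
  have u4 : uniq [:: a; b; c; q].
    move: qn; rewrite /= !inE !negb_or => /and3P [qa qb qc].
    by rewrite ab ac bc ![_ == q]eq_sym qa qb qc.
  have sub : {subset [:: a; b; c; q] <= X} by move=> z; rewrite !inE => /or4P [] /eqP ->.
  by have [_ e] := uniq_min_size u4 sub s4; rewrite e.
have perm1 x : x \in [:: a; b; c; q] -> x \in [:: b; c; a; q].
  by rewrite !inE => /or4P [] ->; rewrite ?orbT.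
have perm2 x : x \in [:: a; b; c; q] -> x \in [:: c; a; b; q].
  by rewrite !inE => /or4P [] ->; rewrite ?orbT.
have hX1 x : x \in X -> x \in [:: b; c; a; q] by move=> /hX /perm1.
have hX2 x : x \in X -> x \in [:: c; a; b; q] by move=> /hX /perm2.
have E1 := empty_tri_rot E; have E2 := empty_tri_rot E1.
have sm := orient_sum a b c q.
move: n1 n2 n3; rewrite !neq_lt => /orP [] h1 /orP [] h2 /orP [] h3.
- lra.
- exact: (reflex_four_hole cf E qX hX).
- exact: (reflex_four_hole cf E2 qX hX2).
- exact: (convex_four_hole cf E qX hX).
- exact: (reflex_four_hole cf E1 qX hX1).
- exact: (convex_four_hole cf E1 qX hX1).
- exact: (convex_four_hole cf E2 qX hX2).
- by case: (eX _ qX).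
Qed.

(** * Three red points *)

Lemma in_tri_uniq a b c p : in_tri a b c p -> uniq [:: a; b; c].
Proof.
move=> /in_tri_gt0 h; have [ab bc ac] := orient_neq (lt0r_neq0 h).
by rewrite /= !inE !negb_or ab ac bc.
Qed.

Lemma three_empty_tri X Y : config X Y -> size X = 3%N -> Y != [::] ->
  (forall y, y \in Y -> in_hull X y) -> exists a b c, empty_tri X Y a b c.
Proof.
move=> cf sX Yn hY; have [y0 y0Y] : exists y, y \in Y.
  by apply: size_gt0_mem; case: Y Yn {cf hY}.
have [a [b [c [aX bX cX T]]]] := in_hull_in_tri cf y0Y (hY _ y0Y).
have h := in_tri_gt0 T; have u3 := in_tri_uniq T.
have hX x : x \in X -> x \in [:: a; b; c].
  have sub : {subset [:: a; b; c] <= X} by move=> z; rewrite !inE => /or3P [] /eqP ->.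
  by have [|_ e] := uniq_min_size u3 sub; rewrite ?sX // e.
have [ab bc ac] := orient_neq (lt0r_neq0 h).
exists a, b, c; split=> //.
  move=> x /hX; rewrite !inE => /or3P [] /eqP -> [h1 h2 h3]; move: h1 h2 h3;
  by rewrite ?orient_l ?orient_r ltxx.
have pos r s y : r \in X -> s \in X -> r != s -> y \in Y ->
    (forall x, x \in X -> 0 <= orient r s x) -> 0 < orient r s y.
  move=> rX sX' rs yY hr; rewrite lt_def (config_orient (config_sym cf)) //.
  exact: in_hull_orient_ge0 hr (hY _ yY).
move=> y yY; split; apply: pos => //; try (by rewrite eq_sym);
  move=> x /hX; rewrite !inE => /or3P [] /eqP ->; rewrite ?orient_l ?orient_r //;
  move: h; rewrite /orient; lra.
Qed.

Lemma empty_tri_perm X Y a b c : uniq X -> size X = 3%N -> Y != [::] -> empty_tri X Y a b c ->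
  perm_eq X [:: a; b; c].
Proof.
move=> uX sX Yn [aX bX cX eX tY]; have [y0 /tY T] : exists y, y \in Y.
  by apply: size_gt0_mem; case: Y Yn {tY}.
have u3 := in_tri_uniq T.
have sub : {subset [:: a; b; c] <= X} by move=> z; rewrite !inE => /or3P [] /eqP ->.
rewrite perm_sym; apply: uniq_perm => //.
by have [|_ e] := uniq_min_size u3 sub; rewrite ?sX // => x; rewrite e.
Qed.

Lemma three_red_hole X Y u v : config X Y -> size X = 3%N ->
  (forall y, y \in Y -> in_hull X y) -> u \in Y -> v \in Y -> u != v ->
  halfplane_two_none u v X Y -> balanced_convex_4hole X Y.
Proof.
move=> cf sX hY uY vY uv H; have [uX uniqY _ _] := cf.
have Yn := mem_neq_nil uY.
have [a [b [c E]]] := three_empty_tri cf sX Yn hY.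
have pX := empty_tri_perm uX sX Yn E.
have two u' v' : edge Y u' v' -> count (fun p => orient u' v' p < 0) X = 2%N ->
    balanced_convex_4hole X Y.
  move=> Eu; rewrite (permP pX) /=.
  have [h1|h1] := ltP (orient u' v' a) 0; have [h2|h2] := ltP (orient u' v' b) 0.
  - by move=> _; apply: (edge_tri_hole cf E Eu).
  - case: (ltP (orient u' v' c) 0) => h3 // _.
    exact: (edge_tri_hole cf (empty_tri_rot (empty_tri_rot E)) Eu).
  - case: (ltP (orient u' v' c) 0) => h3 // _.
    exact: (edge_tri_hole cf (empty_tri_rot E) Eu).
  - by case: (orient u' v' c < 0).
case: H => -[n hn].
  (* The half-plane is to the left of [u v], so the edge is traversed backwards. *)
  apply: (two v u); last by rewrite -n; apply: eq_count => p; rewrite orientN oppr_lt0.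
  split=> //; first by rewrite eq_sym.
  by move=> w wY; rewrite orientN oppr_ge0 leNgt; apply/negP; apply: hn.
by apply: (two u v) => //; split=> // w wY; rewrite leNgt; apply/negP; apply: hn.
Qed.

(* [x] is the point of [Y] where the tangent from [b] touches on the side of [a]. If the hull edge
   leaving [x] is not visible from [a], then [x] lies in every quadrilateral [a b v0 u0]. *)
Lemma adjacent_quad_edge X Y a b c v0 u0 : config X Y -> empty_tri X Y a b c ->
  v0 \in Y -> u0 \in Y -> ccw4 a b v0 u0 ->
  (forall y, y \in Y -> ~~ in_quad a b v0 u0 y) ->
  exists x y, [/\ edge Y x y, orient x y a < 0 & orient x y b < 0].
Proof.
move=> cf [aX bX cX eX tY] v0Y u0Y Q hi; have gpY := config_gp cf.
have [_ q2 q3 _] := Q.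
have vu : v0 != u0 by have [_ ? _] := orient_neq (lt0r_neq0 q2).
have bY : b \notin Y by apply/negP => bY; have := config_neq cf bX bY; rewrite eqxx.
have hd x y : x \in Y -> y \in Y -> orient b x y = 0 -> 0 <= dot b x y.
  move=> xY yY e.
  have [->|xy] := eqVneq x y; first by rewrite /dot addr_ge0 // -expr2 sqr_ge0.
  by have := config_orient cf xY yY bX xy; rewrite -orientC e eqxx.
have ht x y z : x \in Y -> y \in Y -> z \in Y ->
    0 < orient b x y -> 0 < orient b y z -> 0 < orient b z x -> False.
  move=> /tY [_ hx _] /tY [_ hy _] /tY [_ hz _] t1 t2 t3.
  have T : in_tri x y z b by split; rewrite -orientC.
  have : 0 < orient b c b by apply: (in_tri_orient_gt0 T); lra.
  by rewrite orient_l ltxx.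
have [x xY hx] := tangent_point (or_intror (erefl (-1 : F))) (mem_neq_nil v0Y) bY hd ht.
have xb : x != b by apply: contraNneq bY => <-.
have [x0 x0Y x0x] : exists2 x0, x0 \in Y & x0 != x.
  by have [e|n] := eqVneq v0 x; [exists u0; rewrite // -e eq_sym|exists v0].
have tx z : z \in Y -> z != x -> 0 < orient x b z.
  move=> zY zx; rewrite lt_def; apply/andP; split; last by rewrite orientN; have := hx _ zY; lra.
  by rewrite orientN oppr_eq0 orientC; apply: (config_orient cf); rewrite // eq_sym.
(* The tangent [x b] supports [Y] at [x], so [x] has a following vertex [y] and a preceding vertex
   [w]. *)
have [|[y Ey] [w Ew]] := extreme_edges gpY xY x0Y x0x (edge_coef_neq0 xb).
  move=> z zY; rewrite -(edge_functional _ (orient_l x b)).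
  by have [->|/tx/ltW] := eqVneq z x; [rewrite orient_l|apply].
have [_ yY xy hy] := Ey; have [wY _ wx hw] := Ew.
have yb : orient x y b < 0.
  by have := tx _ yY; rewrite eq_sym => /(_ xy); rewrite /orient; lra.
have wb : 0 < orient w x b by have := tx _ wY wx; rewrite /orient; lra.
have := config_orient cf xY yY aX xy; rewrite neq_lt => /orP [ya|ya]; first by exists x, y.
have [xab _ _] := tY _ xY.
have tx' z : z \in Y -> z != x -> 0 < orient x z a.
  move=> zY zx; have [ewy|wy] := eqVneq w y.
    have z0 : orient x y z = 0 by have := hy _ zY; have := hw _ zY; rewrite ewy orientN; lra.
    have [e|-> //] := orient_eq0_mem gpY xY yY zY xy z0.
    by rewrite e eqxx in zx.
  have K : 0 < orient w x y.
    by rewrite lt_def hw // (orient_neq0 gpY) // eq_sym.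
  have wa : orient w x a < 0.
    (* Grassmann-Pluecker for [y], [w], [a], [b] seen from [x]: as [a] is not beyond [x y], it must
       be beyond [w x]. *)
    rewrite ltNge; apply/negP => wa.
    have yb' : 0 < - orient x y b by lra.
    have := mulr_gt0 K xab; have := mulr_gt0 ya wb; have := mulr_ge0 (ltW yb') wa.
    by rewrite /orient; lra.
  rewrite lt_def; apply/andP; split.
    by apply: (config_orient cf) => //; rewrite eq_sym.
  have wa' : 0 < - orient w x a by lra.
  rewrite -(pmulr_rge0 _ K).
  have := mulr_ge0 (hy _ zY) (ltW wa'); have := mulr_ge0 (ltW ya) (hw _ zY).
  by rewrite /orient; lra.
have v0x : v0 != x.
  by apply/eqP => e; have := hx _ u0Y; move: q2; rewrite e; lra.
have u0x : u0 != x.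
  apply/eqP => e; have := tx' _ v0Y v0x; move: q3; rewrite e orientN; lra.
have [t1 t2] := (tx _ u0Y u0x, tx' _ u0Y u0x).
suff I : in_quad a b v0 u0 x by have := hi _ xY; rewrite I.
rewrite /in_quad xab /=; apply/and3P; split.
- by rewrite -orientC tx.
(* By [t1], [t2] and [xab], the point [x] is inside the triangle [a b u0], which lies on the inner
   side of [v0 u0]. *)
- rewrite ltNge; apply/negP => hx0.
  have ga : 0 < orient v0 u0 a - orient v0 u0 x by lra.
  have gb : 0 < orient v0 u0 b - orient v0 u0 x by move: q2; rewrite orientC; lra.
  have := mulr_gt0 t1 ga; have := mulr_gt0 t2 gb; have := mulr_ge0_le0 (ltW xab) hx0.
  by rewrite /orient; lra.
- by rewrite -orientC.
Qed.

Lemma tri_side X Y a b c r s : empty_tri X Y a b c -> r \in [:: a; b; c] -> s \in [:: a; b; c] ->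
  r != s -> exists t, empty_tri X Y r s t \/ empty_tri X Y s r t.
Proof.
move=> E; have E1 := empty_tri_rot E; have E2 := empty_tri_rot E1.
rewrite !inE => /or3P [] /eqP -> /or3P [] /eqP ->; rewrite ?eqxx // => _;
  [exists c|exists b|exists c|exists a|exists b|exists a]; by [left|right].
Qed.

(** Two points of [X] span a side of the triangle with [Y] on one side of it. This excludes
    alternating colours; a rotation brings the other patterns to [adjacent_quad_edge]. *)
Lemma tri_hole_visible X Y a b c : config X Y -> empty_tri X Y a b c ->
  (forall x, x \in X -> x \in [:: a; b; c]) -> balanced_convex_4hole X Y ->
  exists r s t u v, [/\ empty_tri X Y r s t, edge Y u v, orient u v r < 0 & orient u v s < 0].
Proof.
move=> cf E hX [p1 [p2 [p3 [p4 [hm hu Q hi [n1 n2]]]]]].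
have [_ _ dis _] := cf.
have nX y : y \in Y -> (y \in X) = false.
  by move=> yY; apply/negP => /dis; rewrite yY.
have col p : p \in [:: p1; p2; p3; p4] -> p \in Y \/ p \in X.
  by move=> /(allP hm); rewrite mem_cat => /orP [];  [right|left].
have alt q1 q2 q3 q4 : ccw4 q1 q2 q3 q4 -> q1 \in X -> q2 \in Y -> q3 \in X -> q4 \in Y -> False.
  move=> [h1 h2 h3 h4] m1 m2 m3 m4.
  have [_ _ q13] := orient_neq (lt0r_neq0 h1).
  have [t [[_ _ _ _ tY]|[_ _ _ _ tY]]] := tri_side E (hX _ m1) (hX _ m3) q13.
    by have [g _ _] := tY _ m2; move: g h1; rewrite /orient; lra.
  by have [g _ _] := tY _ m4; move: g h3; rewrite /orient; lra.
have adj q1 q2 q3 q4 : ccw4 q1 q2 q3 q4 -> (forall p, p \in Y -> ~~ in_quad q1 q2 q3 q4 p) ->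
    q1 \in X -> q2 \in X -> q3 \in Y -> q4 \in Y ->
    exists r s t u v, [/\ empty_tri X Y r s t, edge Y u v, orient u v r < 0 & orient u v s < 0].
  move=> Q' hi' m1 m2 m3 m4; have [h1 h2 h3 h4] := Q'.
  have [q12 _ _] := orient_neq (lt0r_neq0 h1).
  have [t [Et|[_ _ _ _ tY]]] := tri_side E (hX _ m1) (hX _ m2) q12; last first.
    by have [g _ _] := tY _ m3; move: g h1; rewrite /orient; lra.
  have [x [y [Exy g1 g2]]] := adjacent_quad_edge cf Et m3 m4 Q' hi'.
  by exists q1, q2, t, x, y.
have {}hi p : p \in Y -> ~~ in_quad p1 p2 p3 p4 p.
  by move=> pY; apply/negP => /in_quadP; apply: hi; rewrite mem_cat pY orbT.
have hi1 p : p \in Y -> ~~ in_quad p2 p3 p4 p1 p by rewrite in_quad_rot; apply: hi.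
have hi2 p : p \in Y -> ~~ in_quad p3 p4 p1 p2 p by rewrite in_quad_rot; apply: hi1.
have hi3 p : p \in Y -> ~~ in_quad p4 p1 p2 p3 p by rewrite in_quad_rot; apply: hi2.
have Q1 := ccw4_rot Q; have Q2 := ccw4_rot Q1; have Q3 := ccw4_rot Q2.
have c1 : p1 \in Y \/ p1 \in X by apply: col; rewrite !inE eqxx.
have c2 : p2 \in Y \/ p2 \in X by apply: col; rewrite !inE eqxx ?orbT.
have c3 : p3 \in Y \/ p3 \in X by apply: col; rewrite !inE eqxx ?orbT.
have c4 : p4 \in Y \/ p4 \in X by apply: col; rewrite !inE eqxx ?orbT.
move: n1; rewrite /=.
case: c1 => m1; case: c2 => m2; case: c3 => m3; case: c4 => m4;
  rewrite ?m1 ?m2 ?m3 ?m4 ?(nX _ m1) ?(nX _ m2) ?(nX _ m3) ?(nX _ m4) // => _.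
- exact: (adj _ _ _ _ Q2 hi2).
- by case: (alt _ _ _ _ Q1).
- exact: (adj _ _ _ _ Q1 hi1).
- exact: (adj _ _ _ _ Q3 hi3).
- by case: (alt _ _ _ _ Q).
- exact: (adj _ _ _ _ Q hi).
Qed.

Lemma hole_size X Y : balanced_convex_4hole X Y -> (1 < size X)%N.
Proof.
case=> a [b [c [d [hm hu Q hi [n1 n2]]]]].
rewrite -n1 -size_filter; apply: uniq_leq_size; first exact: filter_uniq.
by move=> x; rewrite mem_filter => /andP [].
Qed.

Lemma nested_hole_condition X Y : config X Y -> balanced_convex_4hole X Y ->
  (forall y, y \in Y -> in_hull X y) ->
  [/\ hull_subset Y X, size X = 3%N, (2 <= size Y)%N &
      (exists u v, hull_edge Y u v /\ halfplane_two_none u v X Y)] \/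
  [/\ hull_subset Y X, (4 <= size X)%N & (2 <= size Y)%N].
Proof.
move=> cf H hY; have sY := hole_size (hole_sym H); have [uX uY _ _] := cf.
have sub : hull_subset Y X by move=> p; apply: in_hull_trans.
have [y0 y0Y] := size_gt0_mem (ltnW sY); have Yn := mem_neq_nil y0Y.
have [s4|s3] := ltnP 3 (size X); first by right.
have [a [b [c [aX bX cX T]]]] := in_hull_in_tri cf y0Y (hY _ y0Y).
have e3 : size X = 3%N.
  apply/eqP; rewrite eqn_leq s3; apply: (@uniq_leq_size _ [:: a; b; c] X (in_tri_uniq T)).
  by move=> z; rewrite !inE => /or3P [] /eqP ->.
left; split=> //.
have [a' [b' [c' E]]] := three_empty_tri cf e3 Yn hY.
have hX x : x \in X -> x \in [:: a'; b'; c'] by rewrite (perm_mem (empty_tri_perm uX e3 Yn E)).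
have [r [s [t [u [v [E' Eu hr hs]]]]]] := tri_hole_visible cf E hX H.
have [uY' vY uv hB] := Eu; have [rX sX tX eX tY] := E'.
exists u, v; split; first by split=> //; left.
right; split; last by move=> p /hB; rewrite leNgt => /negP.
rewrite (permP (empty_tri_perm uX e3 Yn E')) /= hr hs.
(* A third vertex beyond [u v] would put the whole triangle, including [u], strictly beyond that
   line. *)
case: ltP => // ht.
have : 0 < orient v u u by apply: (in_tri_orient_gt0 (tY _ uY')); rewrite !(orientN u v); lra.
by rewrite orient_r ltxx.
Qed.

(** * Overlapping hulls *)

(** Going from [p] to [e] along the edge of [X], the point where the hull of [Y] is left lies on
    both boundaries. *)
Lemma edge_leave X Y s s' p e : config X Y -> (1 < size Y)%N -> edge X s s' ->
  orient s s' p = 0 -> in_hull X p -> in_hull Y p -> e \in X -> orient s s' e = 0 ->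
  ~ in_hull Y e -> exists p, on_hull_boundary Y p /\ on_hull_boundary X p.
Proof.
move=> cf sY Es p0 hXp hYp eX e0 ne; have [uX uY _ _] := cf.
have [t [f [f' [t01 Ef ef hf]]]] := hull_exit uY (config_gp cf) sY hYp ne.
exists (lerp p e t); split; first exact: edge_boundary Ef ef hf.
apply: (edge_boundary Es); first by rewrite orient_lerp p0 e0 !mulr0 addr0.
by apply: in_hull_lerp => //; apply: in_hull_mem.
Qed.

(** Hull membership is a [Prop], so this filter is built by excluded middle. *)
Lemma filter_classical (P : point F -> Prop) X : uniq X ->
  exists2 G, uniq G & forall x, x \in G <-> x \in X /\ P x.
Proof.
elim: X => [_|y X IH /= /andP [yX /IH [G uG hG]]].
  by exists [::] => // x; split=> // -[].
have [Py|nPy] := classic (P y).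
  exists (y :: G) => /=; first by rewrite uG andbT; apply/negP => /hG []; rewrite (negbTE yX).
  move=> x; rewrite !inE; split.
    by move=> /orP [/eqP ->|/hG [-> ?]]; rewrite ?eqxx ?orbT.
  by move=> [/orP [->|xX] Px] //; apply/orP; right; apply/hG.
exists G => // x; rewrite inE; split; first by move=> /hG [-> ?]; rewrite orbT.
by move=> [/orP [/eqP ->|xX] Px] //; apply/hG.
Qed.

(* If no boundary point is shared, then the hull vertices of [X] inside the hull of [Y] are closed
   under passing to the next hull vertex, which forces all of [X] into the hull of [Y]. *)
Lemma overlapping_boundaries X Y x y : config X Y -> (1 < size X)%N -> (1 < size Y)%N ->
  ~ lin_separable X Y -> x \in X -> ~ in_hull Y x -> y \in Y -> ~ in_hull X y ->
  exists p, on_hull_boundary Y p /\ on_hull_boundary X p.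
Proof.
move=> cf sX sY nsep xX hx yY hy; apply: NNPP => N; have [uX uY dis gp] := cf.
have gpX := config_gp (config_sym cf).
have [z zX zY] := common_point uX uY (mem_neq_nil xX) (mem_neq_nil yY) dis nsep.
(* The way from the common point [z] to [y] leaves the hull of [X] through an edge at a point still
   in the hull of [Y]. Both ends of this edge start the walk. *)
have [t [s [s' [t01 Es es hs]]]] := hull_exit uX gpX sX zX hy.
have [sX1 sX2 ss _] := Es.
have hs' : in_hull Y (lerp z y t) by apply: in_hull_lerp => //; apply: in_hull_mem.
have sY1 : in_hull Y s.
  by apply: NNPP => n; apply: N; apply: (edge_leave cf sY Es es hs hs' sX1); rewrite ?orient_l.
have sY2 : in_hull Y s'.
  by apply: NNPP => n; apply: N; apply: (edge_leave cf sY Es es hs hs' sX2); rewrite ?orient_r.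
have [G uG hG] := filter_classical (fun g => in_hull Y g /\ exists g', edge X g g') uX.
have closed g g' : g \in G -> edge X g g' -> g' \in G.
  move=> /hG [gX [gY _]] Eg; have [_ gX' _ _] := Eg; apply/hG; split=> //; split.
    apply: NNPP => n; apply: N; apply: (edge_leave cf sY Eg _ _ gY gX' _ n);
      by rewrite ?orient_l ?orient_r //; apply: in_hull_mem.
  exact: edge_next Eg.
have sG : s \in G by apply/hG; split=> //; split=> //; exists s'.
have sG' := closed _ _ sG Es.
have GX g : g \in G -> g \in X by move=> /hG [].
have gpG : general_position G by move=> p q r /GX ? /GX ? /GX ?; apply: gpX.
have size_G : (1 < size G)%N.
  apply: (@uniq_leq_size _ [:: s; s']); first by rewrite /= inE ss.
  by move=> g; rewrite !inE => /orP [] /eqP ->.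
have nG : ~ in_hull G x by move=> h; apply: hx; apply: in_hull_trans h => g /hG [_ []].
have [|u [v [[uG' vG uv hB] h]]] := hull_edge_visible uG gpG size_G _ nG.
  have xn g : g \in G -> x != g by move=> /hG [_ [gY _]]; apply: contra_not_neq hx => ->.
  by move=> u v uG' vG uv; apply: (orient_neq0 gpX) => //; rewrite ?GX ?xn.
(* The successor [u'] of [u] in [X] belongs to [G]. Each of [v], [u'] is weakly left of the edge
   from [u] to the other, so they coincide, and then [x] cannot be beyond [u v]. *)
have [_ [_ [u' Eu]]] := (hG u).1 uG'.
have uG'' := closed _ _ uG' Eu; have [_ uX' uu hu] := Eu.
have e0 : orient u v u' = 0.
  have := hB _ uG''; have := hu _ (GX _ vG); rewrite /orient; lra.
have [e|e] := orient_eq0_mem gpG uG' vG uG'' uv e0; first by rewrite e eqxx in uu.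
by have := hu _ xX; rewrite e leNgt h.
Qed.

End BalancedHoles.

(** * Assembling the five cases *)

Theorem theorem3 (R : realFieldType) (Rd Bl : seq (point R)) :
  uniq Rd -> uniq Bl -> (forall p, p \in Rd -> p \notin Bl) ->
  general_position (Rd ++ Bl) ->
  ~ lin_separable Rd Bl ->
  (balanced_convex_4hole Rd Bl <->
   ([/\ hull_subset Bl Rd, size Rd = 3%N, (2 <= size Bl)%N &
          (exists u v, hull_edge Bl u v /\ halfplane_two_none u v Rd Bl)]
    \/ [/\ hull_subset Rd Bl, size Bl = 3%N, (2 <= size Rd)%N &
          (exists u v, hull_edge Rd u v /\ halfplane_two_none u v Bl Rd)]
    \/ [/\ hull_subset Bl Rd, (4 <= size Rd)%N & (2 <= size Bl)%N]
    \/ [/\ hull_subset Rd Bl, (4 <= size Bl)%N & (2 <= size Rd)%N]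
    \/ (exists p, on_hull_boundary Bl p /\ on_hull_boundary Rd p))).
Proof.
move=> uR uB dis gp nsep.
have cf : config Rd Bl by split.
have cf' := config_sym cf.
have three X Y : config X Y -> hull_subset Y X -> size X = 3%N ->
    (exists u v, hull_edge Y u v /\ halfplane_two_none u v X Y) -> balanced_convex_4hole X Y.
  move=> c sub s3 [u [v [[uY vY uv _] h]]]; apply: (three_red_hole c s3 _ uY vY uv h).
  by move=> y yY; apply: sub; apply: in_hull_mem => //; case: c.
have four X Y : config X Y -> hull_subset Y X -> (4 <= size X)%N -> (2 <= size Y)%N ->
    balanced_convex_4hole X Y.
  move=> c sub s4 s2; have [y0 y0Y] := size_gt0_mem (ltnW s2).
  have [|//|[a [b [d E]]]] := hole_or_empty_tri c (mem_neq_nil y0Y).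
    by move=> y yY; apply: sub; apply: in_hull_mem => //; case: c.
  exact: empty_tri_hole c E s4 s2.
split; last first.
  case=> [[h1 h2 _ h4]|[[h1 h2 _ h4]|[[h1 h2 h3]|[[h1 h2 h3]|[p [hB hR]]]]]].
  - exact: three.
  - by apply: hole_sym; apply: three.
  - exact: four.
  - by apply: hole_sym; apply: four.
  - exact: shared_boundary_hole cf hR hB.
move=> H.
have [hB|nB] := classic (forall y, y \in Bl -> in_hull Rd y).
  by case: (nested_hole_condition cf H hB); [left|right; right; left].
have [hR|nR] := classic (forall x, x \in Rd -> in_hull Bl x).
  by case: (nested_hole_condition cf' (hole_sym H) hR);
    [right; left|right; right; right; left].
(* Each colour now has a point outside the other hull, which leaves only intersecting boundaries. *)
do 4!right.
have [y ny] := not_all_ex_not _ _ nB; have [yB hy] := imply_to_and _ _ ny.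
have [x nx] := not_all_ex_not _ _ nR; have [xR hx] := imply_to_and _ _ nx.
exact: (overlapping_boundaries cf (hole_size H) (hole_size (hole_sym H)) nsep xR hx yB hy).
Qed.
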